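(* Let $M$ be an $n$-dimensional compact manifold and let $(g_{ij}(t),A_i(t),B_{ij}(t))$ be a smooth solution on $M$ (Riemannian metrics, one-forms, two-forms) of the flow $$\frac{\partial g_{ij}}{\partial t}=-2\left[R_{ij}-\frac14H_{ikl}H_j{}^{kl}-F_i{}^kF_{jk}\right],\qquad \frac{\partial A_i}{\partial t}=-\nabla_kF_i{}^k,\qquad \frac{\partial B_{ij}}{\partial t}=\nabla_kH^k{}_{ij}.$$ Then the Ricci curvature satisfies the evolution equation $$\begin{aligned}\frac{\partial}{\partial t}R_{ik}&=\triangle R_{ik}+2g^{pr}g^{qs}R_{piqk}R_{rs}-2g^{pq}R_{pi}R_{qk}\\&\quad+\frac14g^{jl}\big[\nabla_i\nabla_l(H_{kpq}H_j{}^{pq})-\nabla_i\nabla_k(H_{jpq}H_l{}^{pq})-\nabla_j\nabla_l(H_{kpq}H_i{}^{pq})+\nabla_j\nabla_k(H_{ipq}H_l{}^{pq})\big]\\&\quad+\frac14g^{mn}\big(H_{kpq}H_m{}^{pq}R_{in}-g^{jl}H_{mpq}H_l{}^{pq}R_{ijkn}\big)\\&\quad+g^{jl}\big[\nabla_i\nabla_l(F_k{}^pF_{jp})-\nabla_i\nabla_k(F_j{}^pF_{lp})-\nabla_j\nabla_l(F_k{}^pF_{ip})+\nabla_j\nabla_k(F_i{}^pF_{lp})\big]\\&\quad+g^{mn}\big(F_k{}^pF_{mp}R_{in}-g^{jl}F_m{}^pF_{lp}R_{ijkn}\big).\end{aligned}$$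
   Context: $F=dA$, $H=dB$, i.e. $F_{ij}=\partial_iA_j-\partial_jA_i$ and $H_{ijk}=\partial_iB_{jk}+\partial_jB_{ki}+\partial_kB_{ij}$. Indices are raised and lowered with the evolving metric $g$, repeated indices are summed, $\nabla$ is its Levi-Civita connection with Christoffel symbols $\Gamma^k_{ij}$, and $\triangle=g^{ij}\nabla_i\nabla_j$. Curvature conventions: $R^k_{ijl}=\partial_i\Gamma^k_{jl}-\partial_j\Gamma^k_{il}+\Gamma^k_{ip}\Gamma^p_{jl}-\Gamma^k_{jp}\Gamma^p_{il}$, $R_{ijkl}=g_{kp}R^p_{ijl}$, $R_{ik}=g^{jl}R_{ijkl}$. *)

(* Defs.v *)
From HB Require Import structures.
From mathcomp Require Import all_boot all_order all_algebra.
From mathcomp Require Import all_classical all_reals all_analysis.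

Set Implicit Arguments.
Unset Strict Implicit.
Unset Printing Implicit Defensive.
Import Order.TTheory GRing.Theory Num.Theory.
Import numFieldNormedType.Exports.

Local Open Scope classical_set_scope.
Local Open Scope ring_scope.

Section Smoothness.
Context {R : realType} {V W : normedModType R}.

(* C^k on an open set U: all iterated directional derivatives of order <= k
   exist and are continuous on U.  Since V is finite dimensional in every use,
   quantifying over all directions amounts to using partial derivatives. *)
Fixpoint Ck_on (k : nat) (U : set V) (f : V -> W) : Prop :=
  (forall x, U x -> {for x, continuous f}) /\
  match k with
  | 0 => True
  | k'.+1 => forall v : V,
      (forall x, U x -> derivable f x v) /\ Ck_on k' U (fun x => 'D_v f x)
  end.

Definition smooth_on (U : set V) (f : V -> W) : Prop := forall k, Ck_on k U f.

(* Smoothness on a set D that need not be open (such as [0, T[ times an open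
   set): f has, near each point of D, a smooth extension to an open set. *)
Definition smooth_within (D : set V) (f : V -> W) : Prop :=
  forall p, D p -> exists (O : set V) (F : V -> W),
    [/\ open O, O p, smooth_on O F & forall q, O q -> D q -> f q = F q].

End Smoothness.

(* f'(t) = l, the limit being taken within J, hence one-sided at an endpoint
   of J that belongs to J. *)
Definition has_deriv_within {R : realType} (J : set R) (f : R -> R)
    (t l : R) : Prop :=
  (f s - f t) / (s - t) @[s --> within J t^'] --> l.

(* [coord] and [param] are total functions; only their values on the chart
   domain and on its image matter. *)
Record chart (R : realType) (n : nat) (M : topologicalType) := Chart {
  cdom : set M;
  coord : M -> 'rV[R]_n;
  param : 'rV[R]_n -> M;
  cdom_open : open cdom;
  cimg_open : open (coord @` cdom);
  coordK : forall p, cdom p -> param (coord p) = p;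
  coord_cont : {within cdom, continuous coord};
  param_cont : {within coord @` cdom, continuous param} }.

Definition cimg (R : realType) (n : nat) (M : topologicalType)
  (c : chart R n M) : set 'rV[R]_n := coord c @` cdom c.

(* Change of coordinates from c to d, defined on [overlap c d]. *)
Definition transition (R : realType) (n : nat) (M : topologicalType)
  (c d : chart R n M) : 'rV[R]_n -> 'rV[R]_n := coord d \o param c.

Definition overlap (R : realType) (n : nat) (M : topologicalType)
  (c d : chart R n M) : set 'rV[R]_n := coord c @` (cdom c `&` cdom d).

(* The atlas is any smooth atlas, possibly the maximal one. *)
Record smooth_manifold (R : realType) (n : nat) := SmoothManifold {
  carrier :> topologicalType;
  atlas : set (chart R n carrier);
  manifold_hausdorff : hausdorff_space carrier;
  manifold_second_countable : @second_countable carrier;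
  atlas_cover : forall p : carrier, exists2 c, atlas c & cdom c p;
  atlas_smooth : forall c d, atlas c -> atlas d ->
    smooth_on (overlap c d) (transition c d) }.

Section LocalTensorCalculus.
Context {R : realType} {n : nat}.

(* Everything below lives in one coordinate patch; a covariant tensor is given
   by its component functions T i j ... : 'rV[R]_n -> R. *)
Local Notation fld := ('rV[R]_n -> R).
Local Notation fld2 := ('I_n -> 'I_n -> fld).
Local Notation fld3 := ('I_n -> 'I_n -> 'I_n -> fld).

Definition pd (i : 'I_n) (f : fld) : fld :=
  fun x => 'D_(delta_mx 0 i : 'rV[R]_n) (f : _ -> R^o) x.

Variable g : 'rV[R]_n -> 'M[R]_n.

(* g^{ij} *)
Definition ginv (i j : 'I_n) : fld := fun x => invmx (g x) i j.

(* christoffel k i j = Gamma^k_{ij} *)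
Definition christoffel : fld3 := fun k i j x =>
  2^-1 * \sum_l ginv k l x *
    (pd i (fun y => g y j l) x + pd j (fun y => g y i l) x
     - pd l (fun y => g y i j) x).

(* riem_up k i j l = R^k_{ijl} *)
Definition riem_up (k i j l : 'I_n) : fld := fun x =>
  pd i (christoffel k j l) x - pd j (christoffel k i l) x
  + \sum_p (christoffel k i p x * christoffel p j l x
            - christoffel k j p x * christoffel p i l x).

(* riem i j k l = R_{ijkl} = g_{kp} R^p_{ijl} *)
Definition riem (i j k l : 'I_n) : fld := fun x =>
  \sum_p g x k p * riem_up p i j l x.

(* ricci i k = R_{ik} = g^{jl} R_{ijkl} *)
Definition ricci : fld2 := fun i k x =>
  \sum_j \sum_l ginv j l x * riem i j k l x.

(* nabla2 T a i j = nabla_a T_{ij} *)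
Definition nabla2 (T : fld2) : fld3 := fun a i j x =>
  pd a (T i j) x
  - \sum_p (christoffel p a i x * T p j x + christoffel p a j x * T i p x).

(* nabla3 T a i j k = nabla_a T_{ijk} *)
Definition nabla3 (T : fld3) (a i j k : 'I_n) : fld := fun x =>
  pd a (T i j k) x
  - \sum_p (christoffel p a i x * T p j k x + christoffel p a j x * T i p k x
            + christoffel p a k x * T i j p x).

(* hess T a b i j = nabla_a nabla_b T_{ij} *)
Definition hess (T : fld2) (a b i j : 'I_n) : fld := nabla3 (nabla2 T) a b i j.

Definition laplacian (T : fld2) : fld2 := fun i j x =>
  \sum_a \sum_b ginv a b x * hess T a b i j x.

(* sq2 F i j = F_i^k F_{jk} *)
Definition sq2 (F : fld2) : fld2 := fun i j x =>
  \sum_k \sum_l ginv k l x * F i l x * F j k x.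

(* sq3 H i j = H_{ikl} H_j^{kl} *)
Definition sq3 (H : fld3) : fld2 := fun i j x =>
  \sum_k \sum_l \sum_p \sum_q
    ginv k p x * ginv l q x * H i k l x * H j p q x.

(* div2 F i = nabla_k F_i^k *)
Definition div2 (F : fld2) (i : 'I_n) : fld := fun x =>
  \sum_k \sum_l ginv k l x * nabla2 F k i l x.

(* div3 H i j = nabla_k H^k_{ij} *)
Definition div3 (H : fld3) : fld2 := fun i j x =>
  \sum_k \sum_l ginv k l x * nabla3 H k l i j x.

Definition d_one (A : 'rV[R]_n -> 'rV[R]_n) : fld2 := fun i j x =>
  pd i (fun y => A y 0 j) x - pd j (fun y => A y 0 i) x.

Definition d_two (B : 'rV[R]_n -> 'M[R]_n) : fld3 := fun i j k x =>
  pd i (fun y => B y j k) x + pd j (fun y => B y k i) x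
  + pd k (fun y => B y i j) x.

End LocalTensorCalculus.

Section TensorFields.
Context {R : realType} {n : nat} (M : smooth_manifold R n).

(* A time-dependent covariant tensor field on M is the family of its component
   arrays, indexed by chart, time, and point of the chart image, subject to the
   transformation law.  The Jacobian follows the row-vector convention of the
   library: ('J phi x) i a is the derivative of the a-th component of phi in
   the i-th coordinate direction. *)
Definition cov1_family := chart R n M -> R -> 'rV[R]_n -> 'rV[R]_n.
Definition cov2_family := chart R n M -> R -> 'rV[R]_n -> 'M[R]_n.

Definition is_cov1_tensor (J : set R) (T : cov1_family) : Prop :=
  forall c d t x, atlas c -> atlas d -> J t -> overlap c d x ->
    T c t x = T d t (transition c d x) *m (jacobian (transition c d) x)^T.

Definition is_cov2_tensor (J : set R) (T : cov2_family) : Prop :=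
  forall c d t x, atlas c -> atlas d -> J t -> overlap c d x ->
    T c t x = jacobian (transition c d) x *m T d t (transition c d x)
                *m (jacobian (transition c d) x)^T.

Definition smooth_cov1 (J : set R) (T : cov1_family) : Prop :=
  is_cov1_tensor J T /\
  forall c i, atlas c ->
    smooth_within (J `*` cimg c)
      (fun q : R^o * 'rV[R]_n => T c q.1 q.2 0 i : R^o).

Definition smooth_cov2 (J : set R) (T : cov2_family) : Prop :=
  is_cov2_tensor J T /\
  forall c i j, atlas c ->
    smooth_within (J `*` cimg c)
      (fun q : R^o * 'rV[R]_n => T c q.1 q.2 i j : R^o).

Definition metric_family (J : set R) (g : cov2_family) : Prop :=
  smooth_cov2 J g /\
  forall c t x, atlas c -> J t -> cimg c x ->
    (g c t x)^T = g c t x /\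
    forall v : 'rV[R]_n, v != 0 -> 0 < (v *m g c t x *m v^T) 0 0.

Definition two_form_family (J : set R) (B : cov2_family) : Prop :=
  smooth_cov2 J B /\
  forall c t x, atlas c -> J t -> cimg c x -> (B c t x)^T = - B c t x.

Record flow_solution (J : set R) (g : cov2_family) (A : cov1_family)
    (B : cov2_family) : Prop := FlowSolution {
  flow_metric : metric_family J g;
  flow_one_form : smooth_cov1 J A;
  flow_two_form : two_form_family J B;
  flow_g : forall c t x i j, atlas c -> J t -> cimg c x ->
    has_deriv_within J (fun s => g c s x i j) t
      (- 2 * (ricci (g c t) i j x
              - 4^-1 * sq3 (g c t) (d_two (B c t)) i j x
              - sq2 (g c t) (d_one (A c t)) i j x));
  flow_A : forall c t x i, atlas c -> J t -> cimg c x ->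
    has_deriv_within J (fun s => A c s x 0 i) t
      (- div2 (g c t) (d_one (A c t)) i x);
  flow_B : forall c t x i j, atlas c -> J t -> cimg c x ->
    has_deriv_within J (fun s => B c s x i j) t
      (div3 (g c t) (d_two (B c t)) i j x) }.

End TensorFields.

(* Main.v *)
Require Import Defs.
From HB Require Import structures.
From mathcomp Require Import all_boot all_order all_algebra.
From mathcomp Require Import all_classical all_reals all_analysis.
From mathcomp Require Import ring lra.
Import Order.TTheory GRing.Theory Num.Theory.
Import numFieldNormedType.Exports.

(** The time derivative h of the metric enters the derivative of the Ricci
    tensor linearly: 2 dR_ik/dt = L(h)_ik, where
      L(h)_ik = g^{jl} (D_i D_l h_kj - D_i D_k h_jl - D_j D_l h_ki + D_j D_k h_il)
                + g^{mn} (h_km R_in - g^{jl} h_ml R_ijkn)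
    and D is the Levi-Civita connection ([dricci_var]).  Along the flow
    h = -2 Rc + (1/2) HH + 2 FF, where HH and FF are the squares of H and F, so
    half of L(h) is -L(Rc) + (1/4) L(HH) + L(FF).  The last two terms are the
    terms of the evolution equation that involve H and F.  In L(Rc) the second
    derivatives of Rc other than the Laplacian cancel, up to commutators, because
    the divergence of Rc is half the gradient of its trace ([div_dricci]); the
    Ricci identity turns the commutators into curvature terms, and
      L(Rc)_ik = - Lap R_ik - 2 R_piqk R^pq + 2 R_ip R^p_k ([dlin_ricci_dricci]).

    These are identities of differential algebra.  They are proved over a
    commutative ring with commuting derivations d_1, ..., d_n and dt, in which 2
    is invertible, for a symmetric invertible matrix g.  The Christoffel symbols
    form matrices G_a, and the Ricci identity, the second Bianchi identity and
    the variation of the curvature come from identities between the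
    noncommuting matrices G_a, d_b G_a, ... ([cov_bilin_comm], [curv_bianchi2],
    [curv_var]); symmetry of the Christoffel symbols, metric compatibility and
    contractions do the rest.

    The ring to which this applies consists of the functions that are smooth on
    an open set O of space-time around the given point.  Its derivations
    commute by the symmetry of second derivatives ([derive_comm]), and O is so
    small that the components of g, A and B extend to O and that g is
    invertible there ([local_smooth_extension]).  An element of the ring
    realizes a time-dependent coordinate expression if the two agree at the
    points of O whose time lies in J.  Realization is preserved by spatial
    derivatives, since O is open in the spatial directions, hence by every
    tensor of the coordinate calculus.  The interval J may contain its
    endpoints, and there the extension of dg/dt has no reason to satisfy the
    flow equation off J; but it realizes the right-hand side of the flow, a
    derivative within J being unique ([has_deriv_within_unique]), and this is
    enough because L only involves spatial derivatives of h. *)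

Set Implicit Arguments.
Unset Strict Implicit.
Unset Printing Implicit Defensive.

Local Open Scope classical_set_scope.
Local Open Scope ring_scope.

(** * Derivations of a commutative ring *)

Section Derivations.
Context {S : comPzRingType}.

Definition derivation (D : S -> S) : Prop :=
  (forall x y, D (x + y) = D x + D y) /\
  (forall x y, D (x * y) = D x * y + x * D y).

Variables (D : S -> S) (derD : derivation D).

Lemma derD0 : D 0 = 0.
Proof. by apply: (addrI (D 0)); rewrite -derD.1 !addr0. Qed.

Lemma der1 : D 1 = 0.
Proof.
by apply: (addrI (D 1)); rewrite addr0 -{3}(mulr1 1) derD.2 mulr1 mul1r.
Qed.

Lemma derN x : D (- x) = - D x.
Proof. by apply/eqP; rewrite -addr_eq0 addrC -derD.1 subrr derD0. Qed.

Lemma derB x y : D (x - y) = D x - D y.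
Proof. by rewrite derD.1 derN. Qed.

Lemma der_sum I (r : seq I) (P : pred I) (f : I -> S) :
  D (\sum_(i <- r | P i) f i) = \sum_(i <- r | P i) D (f i).
Proof. exact: (big_morph D derD.1 derD0). Qed.

Lemma der_half c : c + c = 1 -> D c = 0.
Proof.
move=> c2; have Dc2 : D c + D c = 0 by rewrite -derD.1 c2 der1.
by rewrite -[D c]mul1r -c2 mulrDl -mulrDr Dc2 mulr0.
Qed.

Definition dmx {m n} (X : 'M[S]_(m, n)) : 'M[S]_(m, n) := map_mx D X.

Lemma dmxD m n (X Y : 'M[S]_(m, n)) : dmx (X + Y) = dmx X + dmx Y.
Proof. by apply/matrixP=> i j; rewrite !mxE derD.1. Qed.

Lemma dmxN m n (X : 'M[S]_(m, n)) : dmx (- X) = - dmx X.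
Proof. by apply/matrixP=> i j; rewrite !mxE derN. Qed.

Lemma dmxM m n p (X : 'M[S]_(m, n)) (Y : 'M[S]_(n, p)) :
  dmx (X *m Y) = dmx X *m Y + X *m dmx Y.
Proof.
apply/matrixP=> i j; rewrite !mxE der_sum -big_split /=.
by apply: eq_bigr => k _; rewrite !mxE derD.2.
Qed.

Lemma dmx_tr m n (X : 'M[S]_(m, n)) : dmx X^T = (dmx X)^T.
Proof. by apply/matrixP=> i j; rewrite !mxE. Qed.

Lemma entryD m n (X Y : 'M[S]_(m, n)) i j : (X + Y) i j = X i j + Y i j.
Proof. by rewrite mxE. Qed.

Lemma entryN m n (X : 'M[S]_(m, n)) i j : (- X) i j = - X i j.
Proof. by rewrite mxE. Qed.

End Derivations.

(** * Connections and their curvature as matrices *)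

(** A connection is given by matrices G a, with (G a) k l standing for the
    Christoffel symbol Gamma^k_{al}.  Keeping the direction a outside the matrix
    makes the curvature a commutator of d a + G a and d b + G b, and the identities
    below become polynomial identities between noncommuting matrices. *)
Section Connection.
Context {S : comPzRingType} {n : nat}.
Variables (d : 'I_n -> S -> S).
Hypothesis d_der : forall i, derivation (d i).
Hypothesis d_comm : forall i j x, d i (d j x) = d j (d i x).
Variable G : 'I_n -> 'M[S]_n.

(** Covariant derivatives in the direction a of a bilinear form X_{kl} and of an
    endomorphism X^k_l.  Any further index of X, such as the direction of an
    earlier derivative, is a label that receives no Christoffel term. *)
Definition cov_bilin a (X : 'M[S]_n) := dmx (d a) X - (G a)^T *m X - X *m G a.
Definition cov_end a (X : 'M[S]_n) := dmx (d a) X + G a *m X - X *m G a.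
(** The entry k, l is R^k_{abl}. *)
Definition curv a b :=
  dmx (d a) (G b) - dmx (d b) (G a) + G a *m G b - G b *m G a.

Lemma dmx_comm a b (X : 'M[S]_n) :
  dmx (d a) (dmx (d b) X) = dmx (d b) (dmx (d a) X).
Proof. by apply/matrixP=> i j; rewrite !mxE d_comm. Qed.

Let mx_expand := (@mulmxDr S, @mulmxDl S, @mulNmx S, @mulmxN S, @mulmxA S).

(* After distribution, a noncommutative polynomial identity becomes, entry by
   entry, a linear identity between the entries of the monomials. *)
Ltac mx_ring :=
  rewrite ?mx_expand; apply/matrixP=> ? ?; rewrite ?(entryD, entryN); ring.

Lemma cov_bilinM a X Y :
  cov_bilin a (X *m Y) = cov_bilin a X *m Y + X *m cov_end a Y.
Proof. by rewrite /cov_bilin /cov_end dmxM //; mx_ring. Qed.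

(** The Ricci identity: as directions are labels, the commutator is curvature alone. *)
Lemma cov_bilin_comm a b X :
  cov_bilin a (cov_bilin b X) - cov_bilin b (cov_bilin a X) =
  - ((curv a b)^T *m X + X *m curv a b).
Proof.
have trD (A B : 'M[S]_n) : (A + B)^T = A^T + B^T by exact: raddfD.
have trN (A : 'M[S]_n) : (- A)^T = - A^T by exact: raddfN.
have trM (A B : 'M[S]_n) : (A *m B)^T = B^T *m A^T by exact: trmx_mul.
rewrite /cov_bilin /curv !(trD, trN, trM).
rewrite !(dmxD (d_der _), dmxN (d_der _), dmxM (d_der _)) !dmx_tr (dmx_comm a b).
mx_ring.
Qed.

(** The curvature is a quadratic polynomial in G and its derivatives, and its
    linearisation in the direction D G is the covariant curl of D G. *)
Lemma curv_var D a b : derivation D -> (forall i x, D (d i x) = d i (D x)) ->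
  dmx D (curv a b) = cov_end a (dmx D (G b)) - cov_end b (dmx D (G a)).
Proof.
move=> derD commD; rewrite /cov_end /curv.
rewrite !(dmxD derD, dmxN derD, dmxM derD).
have Dd i (X : 'M[S]_n) : dmx D (dmx (d i) X) = dmx (d i) (dmx D X).
  by apply/matrixP=> ? ?; rewrite !mxE commD.
rewrite !Dd; mx_ring.
Qed.

(** Second Bianchi identity: it amounts to d_comm and the Jacobi identity. *)
Lemma curv_bianchi2 a b c :
  cov_end a (curv b c) + cov_end b (curv c a) + cov_end c (curv a b) = 0.
Proof.
rewrite /cov_end /curv.
rewrite !(dmxD (d_der _), dmxN (d_der _), dmxM (d_der _)).
rewrite (dmx_comm a b) (dmx_comm b c) (dmx_comm c a).
rewrite -[RHS](subrr (G a)); mx_ring.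
Qed.

End Connection.

(** * Levi-Civita calculus over a differential ring *)

(** The calculus of a coordinate patch, with the derivations d i of a ring in the
    place of the partial derivatives and half in the place of 1/2. *)
Section Geometry.
Context {S : comPzRingType} {n : nat}.
Variables (d : 'I_n -> S -> S) (half : S) (g gi : 'I_n -> 'I_n -> S).

Definition dchristoffel (k i j : 'I_n) : S :=
  half * \sum_l gi k l * (d i (g j l) + d j (g i l) - d l (g i j)).

Definition driem_up (k i j l : 'I_n) : S :=
  d i (dchristoffel k j l) - d j (dchristoffel k i l)
  + \sum_p (dchristoffel k i p * dchristoffel p j l - dchristoffel k j p * dchristoffel p i l).

Definition driem (i j k l : 'I_n) : S := \sum_p g k p * driem_up p i j l.

(** Tensors are kept with all indices down, so contractions go through the inverse
    metric gi. *)
Definition gtrace (T : 'I_n -> 'I_n -> S) : S := \sum_j \sum_l gi j l * T j l.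

Definition dricci (i k : 'I_n) : S := gtrace (fun j l => driem i j k l).

Definition dnabla1 (T : 'I_n -> S) (a i : 'I_n) : S :=
  d a (T i) - \sum_p dchristoffel p a i * T p.

Definition dnabla2 (T : 'I_n -> 'I_n -> S) (a i j : 'I_n) : S :=
  d a (T i j) - \sum_p (dchristoffel p a i * T p j + dchristoffel p a j * T i p).

Definition dnabla3 (T : 'I_n -> 'I_n -> 'I_n -> S) (a i j k : 'I_n) : S :=
  d a (T i j k) - \sum_p (dchristoffel p a i * T p j k + dchristoffel p a j * T i p k
                          + dchristoffel p a k * T i j p).

Definition dhess (T : 'I_n -> 'I_n -> S) (a b i j : 'I_n) : S :=
  dnabla3 (dnabla2 T) a b i j.

Hypothesis d_der : forall i, derivation (d i).
Hypothesis d_comm : forall i j x, d i (d j x) = d j (d i x).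
Hypothesis half2 : half + half = 1.
Hypothesis g_sym : forall i j, g i j = g j i.
Hypothesis g_gi : forall i j, \sum_k g i k * gi k j = (i == j)%:R.

Local Notation mx T := (\matrix_(i, j) T i j).
Local Notation Mg := (\matrix_(i, j) g i j).
Local Notation Mgi := (\matrix_(i, j) gi i j).
Local Notation Gm := (fun a => \matrix_(k, l) dchristoffel k a l).

Let dD a := (d_der a).1.
Let dM a := (d_der a).2.
Let dN a := derN (d_der a).
Let dhalf a : d a half = 0 := der_half (d_der a) half2.

Lemma halfK x : half * x + half * x = x.
Proof. by rewrite -mulrDl half2 mul1r. Qed.

Lemma Mg_Mgi : Mg *m Mgi = 1%:M.
Proof.
by apply/matrixP=> i j; rewrite !mxE -g_gi; apply: eq_bigr => k _; rewrite !mxE.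
Qed.

Lemma Mgi_Mg : Mgi *m Mg = 1%:M.
Proof. exact: mulmx1C Mg_Mgi. Qed.

Lemma Mg_tr : Mg^T = Mg.
Proof. by apply/matrixP=> i j; rewrite !mxE g_sym. Qed.

Lemma Mgi_tr : Mgi^T = Mgi.
Proof.
rewrite -[LHS]mulmx1 -Mg_Mgi mulmxA -{1}Mg_tr.
have := congr1 trmx Mg_Mgi; rewrite trmx1 trmx_mul => ->.
by rewrite mul1mx.
Qed.

Lemma gi_sym i j : gi i j = gi j i.
Proof. by have /matrixP/(_ j i) := Mgi_tr; rewrite !mxE. Qed.

Lemma gi_g i j : \sum_k gi i k * g k j = (i == j)%:R.
Proof.
have /matrixP/(_ i j) := Mgi_Mg; rewrite !mxE => <-.
by apply: eq_bigr => k _; rewrite !mxE.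
Qed.

Lemma sum_delta (X : 'I_n -> S) i : \sum_j (i == j)%:R * X j = X i.
Proof.
rewrite (bigD1 i) //= eqxx mul1r big1 ?addr0 // => j /negPf.
by rewrite eq_sym => ->; rewrite mul0r.
Qed.

Lemma sum_mulmx_assoc (A B : 'I_n -> 'I_n -> S) (X : 'I_n -> S) i :
  \sum_k A i k * (\sum_l B k l * X l) = \sum_l (\sum_k A i k * B k l) * X l.
Proof.
under eq_bigr do rewrite mulr_sumr.
rewrite exchange_big; apply: eq_bigr => l _; rewrite mulr_suml.
by apply: eq_bigr => k _; rewrite mulrA.
Qed.

Lemma lowerK (X : 'I_n -> S) i : \sum_k g i k * (\sum_l gi k l * X l) = X i.
Proof. by rewrite sum_mulmx_assoc; under eq_bigr do rewrite g_gi; apply: sum_delta. Qed.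

Lemma raiseK (X : 'I_n -> S) i : \sum_k gi i k * (\sum_l g k l * X l) = X i.
Proof. by rewrite sum_mulmx_assoc; under eq_bigr do rewrite gi_g; apply: sum_delta. Qed.

Lemma dchristoffel_sym k i j : dchristoffel k i j = dchristoffel k j i.
Proof.
by rewrite /dchristoffel; congr (_ * _); apply: eq_bigr => l _; rewrite (g_sym j i); ring.
Qed.

(** Christoffel symbols of the first kind. *)
Lemma lower_dchristoffel m j l : \sum_k g m k * dchristoffel k j l =
  half * (d j (g l m) + d l (g j m) - d m (g j l)).
Proof.
rewrite /dchristoffel -(lowerK (fun m => d j (g l m) + d l (g j m) - d m (g j l)) m).
by rewrite mulr_sumr; apply: eq_bigr => k _; ring.
Qed.

(** * Linearity of the covariant derivatives *)

(* The sums of dnabla2 and dnabla3 are split by index so that ring can treat them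
   as atoms. *)
Lemma dnabla2E T a i j : dnabla2 T a i j =
  d a (T i j) - \sum_p dchristoffel p a i * T p j - \sum_p dchristoffel p a j * T i p.
Proof. by rewrite /dnabla2 big_split /=; ring. Qed.

Lemma dnabla3E T a i j k : dnabla3 T a i j k =
  d a (T i j k) - \sum_p dchristoffel p a i * T p j k - \sum_p dchristoffel p a j * T i p k
  - \sum_p dchristoffel p a k * T i j p.
Proof. by rewrite /dnabla3 !big_split /=; ring. Qed.

Lemma eq_dnabla3 T U : (forall i j k, T i j k = U i j k) ->
  forall a i j k, dnabla3 T a i j k = dnabla3 U a i j k.
Proof.
move=> TU a i j k; rewrite /dnabla3 TU; congr (_ - _).
by apply: eq_bigr => p _; rewrite !TU.
Qed.

Lemma dnabla2D T U a i j :
  dnabla2 (fun i j => T i j + U i j) a i j = dnabla2 T a i j + dnabla2 U a i j.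
Proof.
rewrite /dnabla2 dD addrACA -opprD -big_split /=; congr (_ - _).
by apply: eq_bigr => p _; ring.
Qed.

Lemma dnabla2Z c T a i j : d a c = 0 ->
  dnabla2 (fun i j => c * T i j) a i j = c * dnabla2 T a i j.
Proof.
move=> dc; rewrite /dnabla2 dM dc mul0r add0r mulrBr mulr_sumr; congr (_ - _).
by apply: eq_bigr => p _; ring.
Qed.

Lemma dnabla3D T U a i j k :
  dnabla3 (fun i j k => T i j k + U i j k) a i j k = dnabla3 T a i j k + dnabla3 U a i j k.
Proof.
rewrite /dnabla3 dD addrACA -opprD -big_split /=; congr (_ - _).
by apply: eq_bigr => p _; ring.
Qed.

Lemma dnabla3Z c T a i j k : d a c = 0 ->
  dnabla3 (fun i j k => c * T i j k) a i j k = c * dnabla3 T a i j k.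
Proof.
move=> dc; rewrite /dnabla3 dM dc mul0r add0r mulrBr mulr_sumr; congr (_ - _).
by apply: eq_bigr => p _; ring.
Qed.

Lemma dhessD T U a b i j :
  dhess (fun i j => T i j + U i j) a b i j = dhess T a b i j + dhess U a b i j.
Proof. by rewrite /dhess -dnabla3D; apply: eq_dnabla3 => *; apply: dnabla2D. Qed.

Lemma dhessZ c T a b i j : (forall a, d a c = 0) ->
  dhess (fun i j => c * T i j) a b i j = c * dhess T a b i j.
Proof. by move=> dc; rewrite /dhess -dnabla3Z //; apply: eq_dnabla3 => *; apply: dnabla2Z. Qed.

Lemma dnabla2_sym T a i j : (forall i j, T i j = T j i) ->
  dnabla2 T a i j = dnabla2 T a j i.
Proof.
move=> Ts; rewrite /dnabla2 Ts; congr (_ - _); apply: eq_bigr => p _.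
by rewrite (Ts p j) (Ts i p) addrC.
Qed.

Lemma dhess_sym T a b i j : (forall i j, T i j = T j i) ->
  dhess T a b i j = dhess T a b j i.
Proof.
move=> Ts; have ns c k l := @dnabla2_sym T c k l Ts.
rewrite /dhess !dnabla3E ns.
do 3! under [\sum_p _ * dnabla2 T _ _ _]eq_bigr do rewrite ns.
ring.
Qed.

(** * Contractions *)

Lemma eq_gtrace T U : (forall j l, T j l = U j l) -> gtrace T = gtrace U.
Proof.
by move=> TU; apply: eq_bigr => j _; apply: eq_bigr => l _; rewrite TU.
Qed.

Lemma gtraceD T U : gtrace (fun j l => T j l + U j l) = gtrace T + gtrace U.
Proof.
rewrite /gtrace -big_split; apply: eq_bigr => j _.
by rewrite -big_split; apply: eq_bigr => l _; rewrite mulrDr.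
Qed.

Lemma gtraceZ c T : gtrace (fun j l => c * T j l) = c * gtrace T.
Proof.
rewrite /gtrace mulr_sumr; apply: eq_bigr => j _.
by rewrite mulr_sumr; apply: eq_bigr => l _; ring.
Qed.

Lemma gtraceZr c T : gtrace (fun j l => T j l * c) = gtrace T * c.
Proof. by rewrite mulrC -gtraceZ; apply: eq_gtrace => *; rewrite mulrC. Qed.

Lemma gtraceN T : gtrace (fun j l => - T j l) = - gtrace T.
Proof.
by rewrite -mulN1r -gtraceZ; apply: eq_gtrace => *; rewrite mulN1r.
Qed.

Lemma gtraceB T U : gtrace (fun j l => T j l - U j l) = gtrace T - gtrace U.
Proof. by rewrite gtraceD gtraceN. Qed.

Lemma gtrace_sum I (r : seq I) (T : I -> 'I_n -> 'I_n -> S) :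
  gtrace (fun j l => \sum_(p <- r) T p j l) = \sum_(p <- r) gtrace (T p).
Proof.
rewrite /gtrace [RHS]exchange_big; apply: eq_bigr => j _.
by rewrite [RHS]exchange_big; apply: eq_bigr => l _; rewrite mulr_sumr.
Qed.

Lemma gtrace_tr T : gtrace (fun j l => T l j) = gtrace T.
Proof.
rewrite /gtrace exchange_big; apply: eq_bigr => j _; apply: eq_bigr => l _.
by rewrite gi_sym.
Qed.

Lemma gtrace_gtrace (T : 'I_n -> 'I_n -> 'I_n -> 'I_n -> S) :
  gtrace (fun j l => gtrace (fun p q => T j l p q)) =
  gtrace (fun p q => gtrace (fun j l => T j l p q)).
Proof.
rewrite {1}/gtrace {3}/gtrace; under eq_bigr do (under eq_bigr do rewrite -gtraceZ).
under eq_bigr do rewrite -gtrace_sum.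
rewrite -gtrace_sum /gtrace; apply: eq_bigr => p _; apply: eq_bigr => q _; congr (_ * _).
Qed.

Lemma gtrace_mx T : gtrace T = \tr (Mgi *m mx T).
Proof.
rewrite -gtrace_tr; apply: eq_bigr => j _; rewrite !mxE.
by apply: eq_bigr => l _; rewrite !mxE.
Qed.

(** * Metric compatibility *)

Lemma dnabla2_mx T a : mx (dnabla2 T a) = cov_bilin d Gm a (mx T).
Proof.
apply/matrixP=> i j; rewrite /cov_bilin !mxE dnabla2E; congr (_ - _ - _).
  by apply: eq_bigr => p _; rewrite !mxE.
by apply: eq_bigr => p _; rewrite !mxE mulrC.
Qed.

Lemma dnabla2_g a i j : dnabla2 g a i j = 0.
Proof.
rewrite dnabla2E.
have -> : \sum_p dchristoffel p a i * g p j = \sum_p g j p * dchristoffel p a i.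
  by apply: eq_bigr => p _; rewrite g_sym mulrC.
have -> : \sum_p dchristoffel p a j * g i p = \sum_p g i p * dchristoffel p a j.
  by apply: eq_bigr => p _; rewrite mulrC.
rewrite !lower_dchristoffel (g_sym j i) -[X in X - _ - _](halfK (d a (g i j))); ring.
Qed.

Lemma cov_bilin_g a : cov_bilin d Gm a Mg = 0.
Proof. by rewrite -dnabla2_mx; apply/matrixP=> i j; rewrite !mxE dnabla2_g. Qed.

(** Differentiate g g^{-1} = 1. *)
Lemma dmx_ginv D : derivation D -> dmx D Mgi = - (Mgi *m dmx D Mg *m Mgi).
Proof.
move=> derD; have dmx1 : dmx D (1%:M : 'M[S]_n) = 0.
  apply/matrixP=> i j; rewrite !mxE.
  by case: eqP => _; rewrite ?mulr1n ?mulr0n ?der1 ?derD0.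
have := congr1 (fun X => Mgi *m dmx D X) Mg_Mgi; rewrite dmx1 dmxM // mulmx0.
rewrite mulmxDr !mulmxA Mgi_Mg mul1mx addrC => /eqP.
by rewrite addr_eq0 => /eqP.
Qed.

Lemma der_ginv D j l : derivation D ->
  D (gi j l) = - \sum_a \sum_b gi j a * D (g a b) * gi b l.
Proof.
move=> derD; have /matrixP/(_ j l) := dmx_ginv derD; rewrite !mxE => ->.
congr (- _); rewrite exchange_big; apply: eq_bigr => b _; rewrite !mxE mulr_suml.
by apply: eq_bigr => a _; rewrite !mxE.
Qed.

(** Metric compatibility in contracted form: the Christoffel terms of T cancel
    against the derivative of the inverse metric, by cyclicity of the trace. *)
Lemma gtrace_dnabla2 T a : gtrace (dnabla2 T a) = d a (gtrace T).
Proof.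
have da_tr (X : 'M[S]_n) : d a (\tr X) = \tr (dmx (d a) X).
  by rewrite /mxtrace (der_sum (d_der a)); apply: eq_bigr => i _; rewrite mxE.
have dMg : dmx (d a) Mg = (Gm a)^T *m Mg + Mg *m Gm a.
  apply/eqP; rewrite -subr_eq0 opprD addrA; exact/eqP/cov_bilin_g.
rewrite !gtrace_mx dnabla2_mx da_tr dmxM // dmx_ginv // dMg /cov_bilin.
have trN (X : 'M[S]_n) : \tr (- X) = - \tr X by exact: raddfN.
rewrite !(mulmxDr, mulmxDl, mulNmx, mulmxN) !(mxtraceD, trN) !mulmxA.
rewrite Mgi_Mg mul1mx -(mulmxA _ Mg Mgi) Mg_Mgi mulmx1.
rewrite [\tr (Mgi *m mx T *m Gm a)]mxtrace_mulC mulmxA; ring.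
Qed.

Lemma gtrace_dnabla3 T a i :
  gtrace (fun j k => dnabla3 T a i j k) = dnabla1 (fun i => gtrace (T i)) a i.
Proof.
have e j k : dnabla3 T a i j k = dnabla2 (T i) a j k - \sum_p dchristoffel p a i * T p j k.
  by rewrite dnabla3E dnabla2E; ring.
rewrite (eq_gtrace e) gtraceB (gtrace_dnabla2 (T i) a) gtrace_sum /dnabla1; congr (_ - _).
by apply: eq_bigr => p _; rewrite gtraceZ.
Qed.

(** Move the free index k to the front and contract the last two indices. *)
Lemma gtrace_dnabla3_l T a k :
  gtrace (fun i j => dnabla3 T a i j k) = dnabla1 (fun k => gtrace (fun i j => T i j k)) a k.
Proof.
rewrite -(gtrace_dnabla3 (fun k i j => T i j k)); apply: eq_gtrace => i j.
by rewrite !dnabla3E; ring.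
Qed.

Definition dnabla4 (T : 'I_n -> 'I_n -> 'I_n -> 'I_n -> S) (a i j k l : 'I_n) : S :=
  d a (T i j k l)
  - \sum_p dchristoffel p a i * T p j k l - \sum_p dchristoffel p a j * T i p k l
  - \sum_p dchristoffel p a k * T i j p l - \sum_p dchristoffel p a l * T i j k p.

Lemma gtrace_dnabla4 T a i k :
  gtrace (fun j l => dnabla4 T a i j k l) =
  dnabla2 (fun i k => gtrace (fun j l => T i j k l)) a i k.
Proof.
have e j l : dnabla4 T a i j k l = dnabla2 (fun j l => T i j k l) a j l
    - \sum_p dchristoffel p a i * T p j k l - \sum_p dchristoffel p a k * T i j p l.
  by rewrite /dnabla4 dnabla2E; ring.
rewrite (eq_gtrace e) 2!gtraceB.
rewrite (gtrace_dnabla2 (fun j l => T i j k l) a) !gtrace_sum dnabla2E; congr (_ - _ - _);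
  by apply: eq_bigr => p _; rewrite gtraceZ.
Qed.

(** * Curvature identities *)

Lemma curvE i j p l : curv d Gm i j p l = driem_up p i j l.
Proof.
rewrite /curv /driem_up !mxE -addrA -sumrB; congr (_ - _ + _).
by apply: eq_bigr => q _; rewrite !mxE.
Qed.

Lemma driem_mx i j : mx (driem i j) = Mg *m curv d Gm i j.
Proof.
apply/matrixP=> k l; rewrite !mxE; apply: eq_bigr => p _.
by rewrite curvE mxE.
Qed.

Lemma driem_up_raise p i j l : driem_up p i j l = \sum_q gi p q * driem i j q l.
Proof. by rewrite raiseK. Qed.

Lemma driem_anti12 i j k l : driem i j k l = - driem j i k l.
Proof.
rewrite /driem -sumrN; apply: eq_bigr => p _; rewrite /driem_up.
rewrite -mulrN !opprD opprK -sumrN (addrC (- _) (d i _)).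
congr (_ * (_ + _)); apply: eq_bigr => q _; ring.
Qed.

(** The Ricci identity applied to g, whose covariant derivative vanishes. *)
Lemma driem_anti34 i j k l : driem i j k l = - driem i j l k.
Proof.
have cov0 a : cov_bilin d Gm a 0 = 0.
  rewrite /cov_bilin mul0mx mulmx0 !subr0.
  by apply/matrixP=> p q; rewrite !mxE (derD0 (d_der a)).
have := cov_bilin_comm d_der d_comm Gm i j Mg.
rewrite !cov_bilin_g !cov0 subr0 => /esym/eqP.
rewrite oppr_eq0 -{1}Mg_tr -trmx_mul -driem_mx => /eqP/matrixP/(_ k l).
by rewrite !mxE addrC => /eqP; rewrite addr_eq0 => /eqP.
Qed.

(** Absence of torsion: after symmetrising the Christoffel symbols every term
    occurs twice with opposite signs. *)
Lemma driem_bianchi1 i j k l : driem i j k l + driem j l k i + driem l i k j = 0.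
Proof.
rewrite /driem -!big_split /= big1 // => p _; rewrite -!mulrDr /driem_up.
rewrite (dchristoffel_sym p l i) (dchristoffel_sym p l j) (dchristoffel_sym p j i).
set s1 := \sum_p _; set s2 := \sum_p _; set s3 := \sum_p _.
have s0 : s1 + s2 + s3 = 0.
  rewrite -!big_split /= big1 // => q _.
  by rewrite (dchristoffel_sym q l i) (dchristoffel_sym q l j) (dchristoffel_sym q j i); ring.
by rewrite -[RHS](mulr0 (g k p)) -s0; ring.
Qed.

(** The classical octahedron argument: write the first Bianchi identity with each
    of the four indices in third position, and combine the four identities with
    alternating signs. *)
Lemma driem_pair i j k l : driem i j k l = driem k l i j.
Proof.
have bk := driem_bianchi1 i j k l.
have bl := driem_bianchi1 i j l k.
have bi := driem_bianchi1 j l i k.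
have bj := driem_bianchi1 i l j k.
rewrite (driem_anti34 i j l k) (driem_anti12 j k l i) (driem_anti34 k i l j) in bl.
rewrite (driem_anti34 j l i k) (driem_anti12 l k i j) (driem_anti34 k j i l) in bi.
rewrite (driem_anti12 i l j k) (driem_anti34 l i j k) (driem_anti12 l k j i)
  (driem_anti34 k l j i) in bj.
apply/eqP; rewrite -subr_eq0 -[_ - _]halfK; apply/eqP.
have -> : half * (driem i j k l - driem k l i j) + half * (driem i j k l - driem k l i j) =
  half * ((driem i j k l + driem j l k i + driem l i k j)
    - (- driem i j k l - driem k j l i - driem k i j l)
    + (- driem j l k i - driem k l i j - driem k j l i)
    - (driem l i k j + driem k l i j + driem k i j l)) by ring.
by rewrite bk; move: bl bi bj; rewrite !opprK => -> -> ->; ring.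
Qed.

Lemma dricci_sym i k : dricci i k = dricci k i.
Proof.
by rewrite /dricci -gtrace_tr; apply: eq_gtrace => j l; rewrite driem_pair.
Qed.

(** In dnabla4 the two directions b and c of the curvature get Christoffel terms
    too; these cancel in the cyclic sum because there is no torsion. *)
Lemma driem_bianchi2 a b c k l :
  dnabla4 driem a b c k l + dnabla4 driem b c a k l + dnabla4 driem c a b k l = 0.
Proof.
have e a' b' c' : dnabla4 driem a' b' c' k l = (Mg *m cov_end d Gm a' (curv d Gm b' c')) k l
    - \sum_p dchristoffel p a' b' * driem p c' k l - \sum_p dchristoffel p a' c' * driem b' p k l.
  have -> : Mg *m cov_end d Gm a' (curv d Gm b' c') = cov_bilin d Gm a' (mx (driem b' c')).
    by rewrite driem_mx cov_bilinM // cov_bilin_g mul0mx add0r.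
  by rewrite -dnabla2_mx mxE dnabla2E /dnabla4; ring.
(* The Christoffel terms of the directions cancel in pairs. *)
have swap a' b' c' : \sum_p dchristoffel p a' c' * driem b' p k l =
    - \sum_p dchristoffel p c' a' * driem p b' k l.
  by rewrite -sumrN; apply: eq_bigr => p _; rewrite dchristoffel_sym driem_anti12 mulrN.
rewrite !e (swap a b c) (swap b c a) (swap c a b).
have := congr1 (fun X => (Mg *m X) k l) (curv_bianchi2 d_der d_comm Gm a b c).
rewrite mulmx0 !mulmxDr !entryD [in RHS]mxE => b0.
by rewrite -[RHS]b0; ring.
Qed.

(** The term by which dhess T a b differs from an iterated derivative along labels
    is symmetric in a and b, so only the curvature survives. *)
Lemma ricci_identity T a b i j :
  dhess T a b i j - dhess T b a i j =
  gtrace (fun p q => driem a b i p * T q j + driem a b j p * T i q).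
Proof.
have hE a' b' : dhess T a' b' i j = cov_bilin d Gm a' (cov_bilin d Gm b' (mx T)) i j
    - \sum_p dchristoffel p a' b' * dnabla2 T p i j.
  by rewrite -!dnabla2_mx mxE /dhess dnabla3E [in RHS]dnabla2E; ring.
have s : \sum_p dchristoffel p a b * dnabla2 T p i j = \sum_p dchristoffel p b a * dnabla2 T p i j.
  by apply: eq_bigr => p _; rewrite dchristoffel_sym.
rewrite !hE s opprB addrA subrK.
have /matrixP/(_ i j) := cov_bilin_comm d_der d_comm Gm a b (mx T).
rewrite !(entryD, entryN) => ->.
rewrite gtraceD opprD; congr (_ + _).
  rewrite mxE -sumrN /gtrace [RHS]exchange_big; apply: eq_bigr => p _.
  rewrite [_^T i p]mxE [X in _ * X]mxE curvE driem_up_raise mulr_suml -sumrN; apply: eq_bigr => q _.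
  by rewrite gi_sym (driem_anti34 a b i q); ring.
rewrite mxE -sumrN /gtrace [RHS]exchange_big; apply: eq_bigr => p _.
rewrite [X in X * _]mxE curvE driem_up_raise mulr_sumr -sumrN; apply: eq_bigr => q _.
by rewrite gi_sym (driem_anti34 a b j q); ring.
Qed.

Definition dscal : S := gtrace dricci.

Lemma eq_sumN (c T U : 'I_n -> S) : (forall p, T p = - U p) ->
  \sum_p c p * T p = - \sum_p c p * U p.
Proof. by move=> TU; rewrite -sumrN; apply: eq_bigr => p _; rewrite TU mulrN. Qed.

Lemma dnabla4_driem_anti12 a i j k l : dnabla4 driem a i j k l = - dnabla4 driem a j i k l.
Proof.
rewrite /dnabla4 driem_anti12 dN (eq_sumN _ (fun p => driem_anti12 p j k l)).
rewrite (eq_sumN _ (fun p => driem_anti12 i p k l)) (eq_sumN _ (fun p => driem_anti12 i j p l)).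
by rewrite (eq_sumN _ (fun p => driem_anti12 i j k p)); ring.
Qed.

Lemma dnabla4_driem_anti34 a i j k l : dnabla4 driem a i j k l = - dnabla4 driem a i j l k.
Proof.
rewrite /dnabla4 driem_anti34 dN (eq_sumN _ (fun p => driem_anti34 p j k l)).
rewrite (eq_sumN _ (fun p => driem_anti34 i p k l)) (eq_sumN _ (fun p => driem_anti34 i j p l)).
by rewrite (eq_sumN _ (fun p => driem_anti34 i j k p)); ring.
Qed.

(** Twice contracted second Bianchi identity: by the antisymmetries of the
    curvature, two of its three terms become minus the divergence of Rc. *)
Lemma div_dricci a : gtrace (fun i j => dnabla2 dricci i j a) = half * d a dscal.
Proof.
have s1 : gtrace (fun b k => gtrace (fun c l => dnabla4 driem a b c k l)) = d a dscal.
  by rewrite -gtrace_dnabla2; apply: eq_gtrace => b k; apply: gtrace_dnabla4.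
have s2 : gtrace (fun b k => gtrace (fun c l => dnabla4 driem b c a k l)) =
    - gtrace (fun i j => dnabla2 dricci i j a).
  rewrite -gtraceN; apply: eq_gtrace => b k.
  rewrite (dnabla2_sym _ _ _ dricci_sym) -[dnabla2 _ _ _ _](gtrace_dnabla4 driem b a k) -gtraceN.
  by apply: eq_gtrace => c l; apply: dnabla4_driem_anti12.
have s3 : gtrace (fun b k => gtrace (fun c l => dnabla4 driem c a b k l)) =
    - gtrace (fun i j => dnabla2 dricci i j a).
  rewrite gtrace_gtrace -gtraceN; apply: eq_gtrace => c l.
  rewrite (dnabla2_sym _ _ _ dricci_sym) -[dnabla2 _ _ _ _](gtrace_dnabla4 driem c a l) -gtraceN.
  by apply: eq_gtrace => b k; apply: dnabla4_driem_anti34.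
have s0 : gtrace (fun b k => gtrace (fun c l =>
    dnabla4 driem a b c k l + dnabla4 driem b c a k l + dnabla4 driem c a b k l)) = 0.
  by apply: big1 => b _; apply: big1 => k _; rewrite [gtrace _]big1 ?mulr0 // => c _;
    apply: big1 => l _; rewrite driem_bianchi2 mulr0.
have {}s0 : d a dscal =
    gtrace (fun i j => dnabla2 dricci i j a) + gtrace (fun i j => dnabla2 dricci i j a).
  rewrite -[RHS]addr0 -s0 -s1.
  under [X in _ = _ + X]eq_gtrace => b k do rewrite 2!gtraceD.
  by rewrite 2!gtraceD s2 s3; ring.
by rewrite s0 mulrDr halfK.
Qed.

(** * The linearised Ricci operator *)

(** Twice the derivative of the Ricci tensor when the metric moves with velocity h. *)
Definition dlin_ricci (h : 'I_n -> 'I_n -> S) (i k : 'I_n) : S :=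
  gtrace (fun j l => dhess h i l k j - dhess h i k j l - dhess h j l k i + dhess h j k i l)
  + gtrace (fun m q => h k m * dricci i q - gtrace (fun j l => h m l * driem i j k q)).

Lemma dlin_ricciD h1 h2 i k :
  dlin_ricci (fun i j => h1 i j + h2 i j) i k = dlin_ricci h1 i k + dlin_ricci h2 i k.
Proof.
rewrite /dlin_ricci addrACA; congr (_ + _); rewrite -gtraceD.
  by apply: eq_gtrace => j l; rewrite !dhessD; ring.
apply: eq_gtrace => m q.
under eq_gtrace do rewrite mulrDl.
by rewrite gtraceD; ring.
Qed.

Lemma dlin_ricciZ c h i k : (forall a, d a c = 0) ->
  dlin_ricci (fun i j => c * h i j) i k = c * dlin_ricci h i k.
Proof.
move=> dc; rewrite /dlin_ricci mulrDr; congr (_ + _); rewrite -gtraceZ.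
  by apply: eq_gtrace => j l; rewrite !dhessZ //; ring.
apply: eq_gtrace => m q; rewrite mulrBr -[c * gtrace _]gtraceZ mulrA; congr (_ - _).
by apply: eq_gtrace => j l; rewrite mulrA.
Qed.

(** The third of the four second-derivative terms is minus the Laplacian.  The others
    contain a trace or a divergence of Rc, the fourth one once its two derivatives
    are exchanged; with V the Hessian of the scalar curvature they add up to
    V/2 - V + V/2 = 0, and the exchange leaves curvature terms. *)
Lemma dlin_ricci_dricci i k : dlin_ricci dricci i k =
  - gtrace (fun a b => dhess dricci a b i k)
  - (1 + 1) * gtrace (fun p r => gtrace (fun q s => driem p i q k * dricci r s))
  + (1 + 1) * gtrace (fun p q => dricci p i * dricci q k).
Proof.
have V_sym a b : dnabla1 (fun k => d k dscal) a b = dnabla1 (fun k => d k dscal) b a.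
  by rewrite /dnabla1 d_comm; congr (_ - _); apply: eq_bigr => p _; rewrite dchristoffel_sym.
have divV a b : gtrace (fun j l => dhess dricci a j l b) =
    half * dnabla1 (fun k => d k dscal) a b.
  rewrite gtrace_dnabla3_l /dnabla1 div_dricci dM dhalf mul0r add0r mulrBr mulr_sumr.
  by congr (_ - _); apply: eq_bigr => p _; rewrite div_dricci; ring.
have t1 : gtrace (fun j l => dhess dricci i l k j) = half * dnabla1 (fun k => d k dscal) i k.
  by rewrite -divV -gtrace_tr; apply: eq_gtrace => j l; apply/dhess_sym/dricci_sym.
have t2 : gtrace (fun j l => dhess dricci i k j l) = dnabla1 (fun k => d k dscal) i k.
  rewrite gtrace_dnabla3 /dnabla1 (gtrace_dnabla2 dricci k); congr (_ - _).
  by apply: eq_bigr => p _; rewrite (gtrace_dnabla2 dricci p).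
have t3 : gtrace (fun j l => dhess dricci j l k i) = gtrace (fun j l => dhess dricci j l i k).
  by apply: eq_gtrace => j l; apply/dhess_sym/dricci_sym.
(* Exchanging the derivatives j and k costs a curvature commutator. *)
have t4 : gtrace (fun j l => dhess dricci j k i l) = half * dnabla1 (fun k => d k dscal) i k
    + gtrace (fun j l => gtrace (fun p q => driem j k i p * dricci q l + driem j k l p * dricci i q)).
  rewrite V_sym -divV -gtraceD; apply: eq_gtrace => j l.
  by rewrite -ricci_identity (dhess_sym k j l i dricci_sym); ring.
rewrite /dlin_ricci gtraceD 2!gtraceB t1 t2 t3 t4.
under [X in _ + (_ + X)]eq_gtrace do rewrite gtraceD.
rewrite gtraceD.
have u1 : gtrace (fun j l => gtrace (fun p q => driem j k i p * dricci q l)) =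
    - gtrace (fun p r => gtrace (fun q s => driem p i q k * dricci r s)).
  rewrite gtrace_gtrace -gtraceN; apply: eq_gtrace => p q; rewrite -gtraceN.
  by apply: eq_gtrace => j l; rewrite driem_pair (driem_anti12 p i j k) driem_anti34; ring.
have u2 : gtrace (fun j l => gtrace (fun p q => driem j k l p * dricci i q)) =
    gtrace (fun p q => dricci p i * dricci q k).
  rewrite gtrace_gtrace -gtrace_tr; apply: eq_gtrace => p q.
  rewrite gtraceZr (dricci_sym i) mulrC; congr (_ * _).
  by rewrite (dricci_sym q k); apply: eq_gtrace => j l; rewrite driem_anti12 driem_anti34 opprK.
have u3 : gtrace (fun m q => dricci k m * dricci i q - gtrace (fun j l => dricci m l * driem i j k q)) =
    gtrace (fun p q => dricci p i * dricci q k)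
    - gtrace (fun p r => gtrace (fun q s => driem p i q k * dricci r s)).
  rewrite gtraceB -gtrace_tr; congr (_ - _).
    by apply: eq_gtrace => m q; rewrite (dricci_sym i) (dricci_sym k) mulrC.
  rewrite gtrace_gtrace; apply: eq_gtrace => j l; rewrite -gtrace_tr; apply: eq_gtrace => q m.
  by rewrite driem_anti12 driem_anti34 (dricci_sym m); ring.
rewrite u1 u2 u3.
have := halfK (dnabla1 (fun k => d k dscal) i k); set X := dnabla1 _ i k.
by set Y := half * X => <-; ring.
Qed.

(** * Variation of the curvature along a further derivation *)

Section Variation.
Variable dt : S -> S.
Hypothesis dt_der : derivation dt.
Hypothesis dt_comm : forall i x, dt (d i x) = d i (dt x).

Local Notation h := (fun i j => dt (g i j)).

Let dthalf : dt half = 0 := der_half dt_der half2.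

(** The variation of the Christoffel symbols is a tensor: the part of the
    variation of lower_dchristoffel in which the metric itself varies supplies
    exactly the Christoffel terms of the covariant derivatives of h. *)
Lemma lower_dchristoffel_var m j l : \sum_k g m k * dt (dchristoffel k j l) =
  half * (dnabla2 h j l m + dnabla2 h l j m - dnabla2 h m j l).
Proof.
have := congr1 dt (lower_dchristoffel m j l).
rewrite (der_sum dt_der) dt_der.2 dthalf mul0r add0r (derB dt_der) dt_der.1.
under eq_bigr do rewrite dt_der.2.
rewrite big_split /= !dt_comm => e.
have -> : \sum_k g m k * dt (dchristoffel k j l) =
    half * (d j (h l m) + d l (h j m) - d m (h j l)) - \sum_k h m k * dchristoffel k j l.
  by rewrite -e; ring.
rewrite !dnabla2E.
have e1 : \sum_p dchristoffel p l j * h p m = \sum_p h m p * dchristoffel p j l.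
  by apply: eq_bigr => p _; rewrite dchristoffel_sym g_sym mulrC.
have e2 : \sum_p dchristoffel p j l * h p m = \sum_p h m p * dchristoffel p j l.
  by apply: eq_bigr => p _; rewrite g_sym mulrC.
have e3 : \sum_p dchristoffel p l m * h j p = \sum_p dchristoffel p m l * h j p.
  by apply: eq_bigr => p _; rewrite dchristoffel_sym.
have e4 : \sum_p dchristoffel p m j * h p l = \sum_p dchristoffel p j m * h l p.
  by apply: eq_bigr => p _; rewrite dchristoffel_sym g_sym.
rewrite e1 e2 e3 e4; have := halfK (\sum_k h m k * dchristoffel k j l).
by set X := \sum_k h m k * _ => {1}<-; ring.
Qed.

(** By curv_var this is an antisymmetrised covariant derivative of the variation C
    of the Christoffel symbols; the Christoffel term of the direction label is
    symmetric and drops out. *)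
Lemma lower_driem_up_var i j k l : \sum_p g k p * dt (driem_up p i j l) =
  half * (dhess h i j l k + dhess h i l j k - dhess h i k j l
          - dhess h j i l k - dhess h j l i k + dhess h j k i l).
Proof.
pose C m j l := half * (dnabla2 h j l m + dnabla2 h l j m - dnabla2 h m j l).
have C_mx j' : mx (fun m l => C m j' l) = Mg *m dmx dt (Gm j').
  apply/matrixP=> m l'; rewrite !mxE /C -lower_dchristoffel_var.
  by apply: eq_bigr => p _; rewrite !mxE.
have nablaC a b c e : dnabla3 C a b c e =
    half * (dhess h a c e b + dhess h a e c b - dhess h a b c e).
  rewrite dnabla3Z //; congr (_ * _).
  have -> : dnabla3 (fun m j l => dnabla2 h j l m + dnabla2 h l j m - dnabla2 h m j l) a b c e
      = dnabla3 (fun m j l => dnabla2 h j l m + dnabla2 h l j m) a b c e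
        + dnabla3 (fun m j l => -1 * dnabla2 h m j l) a b c e.
    by rewrite -dnabla3D; apply: eq_dnabla3 => *; rewrite mulN1r.
  have dN1 : d a (-1) = 0 by rewrite dN (der1 (d_der a)) oppr0.
  rewrite dnabla3D (dnabla3Z (fun m j l => dnabla2 h m j l) _ _ _ dN1) mulN1r.
  by congr (_ + _ - _); rewrite /dhess !dnabla3E; ring.
have -> : \sum_p g k p * dt (driem_up p i j l) = (Mg *m dmx dt (curv d Gm i j)) k l.
  by rewrite mxE; apply: eq_bigr => p _; rewrite !mxE -curvE !mxE.
rewrite curv_var // mulmxBr.
have covM a' X : Mg *m cov_end d Gm a' X = cov_bilin d Gm a' (Mg *m X).
  by rewrite cov_bilinM // cov_bilin_g mul0mx add0r.
rewrite !covM -!C_mx -!dnabla2_mx !(entryD, entryN) ![(mx _) k l]mxE.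
have nE a b : dnabla2 (fun m l => C m b l) a k l =
    dnabla3 C a k b l + \sum_p dchristoffel p a b * C k p l.
  by rewrite dnabla3E dnabla2E; ring.
have s : \sum_p dchristoffel p i j * C k p l = \sum_p dchristoffel p j i * C k p l.
  by apply: eq_bigr => p _; rewrite dchristoffel_sym.
by rewrite !nE s !nablaC; ring.
Qed.

Lemma driem_var i j k l : dt (driem i j k l) =
  gtrace (fun p q => h k p * driem i j q l)
  + half * (dhess h i j l k + dhess h i l j k - dhess h i k j l
            - dhess h j i l k - dhess h j l i k + dhess h j k i l).
Proof.
rewrite -lower_driem_up_var (der_sum dt_der); under eq_bigr do rewrite dt_der.2.
rewrite big_split; congr (_ + _); apply: eq_bigr => p _ /=.
by rewrite driem_up_raise mulr_sumr; apply: eq_bigr => q _; ring.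
Qed.

Lemma gtrace_var T : dt (gtrace T) =
  gtrace (fun j l => dt (T j l)) - gtrace (fun j a => gtrace (fun l b => h a b * T j l)).
Proof.
rewrite /gtrace (der_sum dt_der) -sumrB; apply: eq_bigr => j _.
rewrite (der_sum dt_der).
under eq_bigr do rewrite dt_der.2 der_ginv // addrC.
rewrite big_split /=; congr (_ + _).
under [in RHS]eq_bigr do rewrite mulr_sumr.
rewrite exchange_big -sumrN; apply: eq_bigr => l _.
rewrite mulNr mulr_suml; congr (- _); apply: eq_bigr => a _.
rewrite mulr_suml mulr_sumr; apply: eq_bigr => b _.
by rewrite (gi_sym b l); ring.
Qed.

(** Contract driem_var.  The two second derivatives of h that are not in dlin_ricci
    form a commutator, whose curvature terms are minus one half of the terms
    coming from the variation of the metric and of its inverse. *)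
Lemma dricci_var i k : dt (dricci i k) = half * dlin_ricci h i k.
Proof.
have h_sym a b : h a b = h b a by rewrite g_sym.
rewrite /dricci gtrace_var.
under eq_gtrace do rewrite driem_var.
have e j l : half * (dhess h i j l k + dhess h i l j k - dhess h i k j l
            - dhess h j i l k - dhess h j l i k + dhess h j k i l) =
    half * (dhess h i l k j - dhess h i k j l - dhess h j l k i + dhess h j k i l)
    + half * gtrace (fun p q => driem i j l p * h q k + driem i j k p * h l q).
  have /= <- := ricci_identity h i j l k.
  by rewrite (dhess_sym i l k j h_sym) (dhess_sym j l k i h_sym); ring.
under eq_gtrace do rewrite e.
rewrite 2!gtraceD !gtraceZ /dlin_ricci [in RHS]gtraceB.
under [X in _ + (_ + _ * X)]eq_gtrace do rewrite gtraceD.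
rewrite [X in _ + (_ + _ * X)]gtraceD.
set L := gtrace (fun j l => dhess h i l k j - _ - _ + _).
have t1 : gtrace (fun j l => gtrace (fun p q => h k p * driem i j q l)) =
    gtrace (fun m q => h k m * dricci i q).
  by rewrite gtrace_gtrace; apply: eq_gtrace => p q; rewrite gtraceZ.
have t2 : gtrace (fun j l => gtrace (fun p q => driem i j l p * h q k)) =
    - gtrace (fun m q => h k m * dricci i q).
  rewrite gtrace_gtrace -gtrace_tr -gtraceN; apply: eq_gtrace => q p.
  rewrite gtraceZr h_sym mulrC -mulrN -[- dricci i p]gtraceN; congr (_ * _).
  by apply: eq_gtrace => j l; rewrite driem_anti34.
have t3 : gtrace (fun j l => gtrace (fun p q => driem i j k p * h l q)) =
    gtrace (fun j a => gtrace (fun l b => h a b * driem i j k l)).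
  by apply: eq_gtrace => j a; apply: eq_gtrace => l b; rewrite mulrC.
have t4 : gtrace (fun m q => gtrace (fun j l => h m l * driem i j k q)) =
    gtrace (fun j a => gtrace (fun l b => h a b * driem i j k l)).
  rewrite gtrace_gtrace; apply: eq_gtrace => j a; rewrite -gtrace_tr.
  by apply: eq_gtrace => l b; rewrite h_sym.
rewrite t1 t2 t3 t4.
set X := gtrace (fun m q => h k m * dricci i q).
set Y := gtrace (fun j a => gtrace _).
rewrite !mulrDr !mulrN; have := halfK X; have := halfK Y.
by set hX := half * X; set hY := half * Y => <- <-; ring.
Qed.

End Variation.

End Geometry.

(** * Functions of class C^k on an open set *)

Section CkTheory.
Context {R : realType} {V : normedModType R}.
Implicit Types (U : set V) (f g : V -> R^o) (k : nat).

(** Differentiability at a point depends on a neighbourhood only, so openness of U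
    is essential. *)
Lemma Ck_on_ext k U f g : open U -> (forall x, U x -> f x = g x) ->
  Ck_on k U f -> Ck_on k U g.
Proof.
move=> oU; elim: k f g => [|k IH] f g fg [cf df].
all: have nfg x : U x -> \forall y \near x, f y = g y
  by move=> Ux; near=> y; apply: fg; near: y; exact: open_nbhs_nbhs.
all: have cg : forall x, U x -> {for x, continuous g}.
1,3: move=> x Ux; rewrite /prop_for /continuous_at -(fg x Ux); apply: cvg_trans (cf x Ux);
  apply: near_eq_cvg; exact: nfg.
  by split.
split=> // v; have [dfv Ckf] := df v; split.
  by move=> x Ux; apply: (near_eq_derivable (nfg x Ux)); apply: dfv.
by apply: IH Ckf => x Ux; apply: near_eq_derive; apply: nfg.
Unshelve. all: by end_near. Qed.

Lemma Ck_onS k U f : Ck_on k.+1 U f -> Ck_on k U f.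
Proof.
elim: k f => [|k IH] f [cf df]; first by split.
by split=> // v; have [dfv Ckf] := df v; split=> //; apply: IH.
Qed.

Lemma Ck_on_sub k U U' f : U' `<=` U -> Ck_on k U f -> Ck_on k U' f.
Proof.
move=> sU; elim: k f => [|k IH] f [cf df]; split; try by move=> x /sU; apply: cf.
  by [].
by move=> v; have [dfv Cf] := df v; split; [move=> x /sU; apply: dfv | exact: IH].
Qed.

Lemma Ck_on_cst k U (c : R) : Ck_on k U (fun=> c : R^o).
Proof.
have cc c' : forall x, U x -> {for x, continuous (fun=> c' : R^o)}.
  by move=> x _; apply: cst_continuous.
elim: k c => [|k IH] c; (split; first exact: cc) => // v.
split=> [x _|]; first exact: derivable_cst.
have -> : (fun x => 'D_v (fun=> c : R^o) x) = (fun=> 0 : R^o).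
  by apply/funext => x; apply: derive_cst.
exact: IH.
Qed.

Lemma Ck_onB k U f g : open U -> Ck_on k U f -> Ck_on k U g -> Ck_on k U (f - g).
Proof.
move=> oU; elim: k f g => [|k IH] f g [cf df] [cg dg].
all: have c : forall x, U x -> {for x, continuous (f - g)}
  by move=> x Ux; apply: continuousB; [exact: cf | exact: cg].
  by split.
split=> // v; have [dfv Ckf] := df v; have [dgv Ckg] := dg v; split.
  by move=> x Ux; apply: derivableB; [exact: dfv | exact: dgv].
apply: (Ck_on_ext oU _ (IH _ _ Ckf Ckg)) => x Ux.
by rewrite deriveB; [|exact: dfv | exact: dgv].
Qed.

Lemma Ck_onM k U f g : open U -> Ck_on k U f -> Ck_on k U g ->
  Ck_on k U (fun x => f x * g x : R^o).
Proof.
move=> oU; elim: k f g => [|k IH] f g Cf Cg.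
all: have [[cf df] [cg dg]] := (Cf, Cg).
all: have c : forall x, U x -> {for x, continuous (fun x => f x * g x : R^o)}
  by move=> x Ux; apply: (@continuousM R V); [exact: cf | exact: cg].
  by split.
split=> // v; have [dfv Ckf] := df v; have [dgv Ckg] := dg v; split.
  by move=> x Ux; apply: (@derivableM R V); [exact: dfv | exact: dgv].
have C1 := IH _ _ (Ck_onS Cf) Ckg.
have C2 : Ck_on k U (fun x => - (g x * 'D_v f x) : R^o).
  have := Ck_onB oU (Ck_on_cst k U 0) (IH _ _ (Ck_onS Cg) Ckf).
  by apply: Ck_on_ext => // x _; rewrite -[LHS]/(0 - _) sub0r.
apply: (Ck_on_ext oU _ (Ck_onB oU C1 C2)) => x Ux.
rewrite [RHS](@deriveM R V); [|exact: dfv | exact: dgv].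
by rewrite -[LHS]/(_ - - _) opprK.
Qed.

Lemma Ck_onV k U f : open U -> (forall x, U x -> f x != 0) ->
  Ck_on k U f -> Ck_on k U (fun x => (f x)^-1 : R^o).
Proof.
move=> oU f0; elim: k => [|k IH] Cf; have [cf df] := Cf.
all: have c : forall x, U x -> {for x, continuous (fun x => (f x)^-1 : R^o)}
  by move=> x Ux; apply: (@continuousV R V); [exact: f0 | exact: cf].
  by split.
split=> // v; have [dfv Ckf] := df v; split.
  by move=> x Ux; apply: (@derivableV R V); [exact: f0 | exact: dfv].
have CV := IH (Ck_onS Cf).
have := Ck_onB oU (Ck_on_cst k U 0) (Ck_onM oU (Ck_onM oU CV CV) Ckf).
apply: Ck_on_ext => // x Ux; rewrite [RHS](@deriveV R V) ?f0 //; last exact: dfv.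
by rewrite -[LHS]/(0 - _) sub0r scaleNr -exprVn expr2.
Qed.

(** * Symmetry of second derivatives *)

Lemma is_derive_line f (q v : V) (u : R) : derivable f (u *: v + q) v ->
  is_derive u (1 : R) (fun t : R => f (t *: v + q) : R^o) ('D_v f (u *: v + q)).
Proof.
have e : (fun h => h^-1 *: (((fun t => f (t *: v + q)) \o shift u) (h *: 1) - f (u *: v + q)))
  = (fun h => h^-1 *: ((f \o shift (u *: v + q)) (h *: v) - f (u *: v + q))).
  by apply/funext => h /=; rewrite [_%:A]mulr1 scalerDl addrA.
by split; rewrite /derivable /derive e.
Qed.

(** The second difference is symmetric in v and w, and two applications of the mean
    value theorem express it by the derivative along v and then w. *)
Definition second_diff f (x v w : V) (h : R) : R :=
  f (h *: v + h *: w + x) - f (h *: v + x) - f (h *: w + x) + f x.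

Lemma second_diffC f x v w h : second_diff f x v w h = second_diff f x w v h.
Proof. by rewrite /second_diff (addrC (h *: v)); ring. Qed.

Lemma second_diff_mvt U f x v w (h : R) : Ck_on 2 U f -> 0 < h ->
  (forall s t, 0 <= s <= h -> 0 <= t <= h -> U (s *: v + t *: w + x)) ->
  exists s t, [/\ 0 <= s <= h, 0 <= t <= h &
    second_diff f x v w h = h ^+ 2 * 'D_w (fun y => 'D_v f y) (s *: v + t *: w + x)].
Proof.
move=> [cf /(_ v)[df [cdf /(_ w)[ddf _]]]] h0 box.
have I0 : 0 <= (0 : R) <= h by rewrite lexx ltW.
have Ih : 0 <= h <= h by rewrite lexx ltW.
(* Mean value theorem along v for the difference of f along w, then along w for
   the derivative of f along v. *)
pose a (s : R) := f (s *: v + (h *: w + x)) - f (s *: v + x) : R^o.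
have da s : 0 <= s <= h -> is_derive s 1 a
    ('D_v f (s *: v + (h *: w + x)) - 'D_v f (s *: v + x)).
  move=> Is; apply: is_deriveB; apply: is_derive_line; apply: df.
    by rewrite addrA; apply: box.
  by have := box s 0 Is I0; rewrite scale0r addr0.
have [||s + e1] := @MVT R a (fun s => 'D_v f (s *: v + (h *: w + x)) - 'D_v f (s *: v + x)) 0 h h0.
- by move=> s; rewrite in_itv /= => /andP[s0 s1]; apply: da; rewrite !ltW.
- apply: continuous_in_subspaceT => s; rewrite inE /= in_itv /= => Is.
  have [d1 _] := da s Is.
  by apply/differentiable_continuous/derivable1_diffP.
rewrite in_itv /= => /andP[s0 s1]; have Is : 0 <= s <= h by rewrite !ltW.
pose b (t : R) := 'D_v f (t *: w + (s *: v + x)) : R^o.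
have db t : 0 <= t <= h -> is_derive t 1 b
    ('D_w (fun y => 'D_v f y) (t *: w + (s *: v + x))).
  move=> It; apply: (@is_derive_line (fun y => 'D_v f y)); apply: ddf.
  by rewrite addrA (addrC (t *: w)); apply: box.
have [||t + e2] := @MVT R b (fun t => 'D_w (fun y => 'D_v f y) (t *: w + (s *: v + x))) 0 h h0.
- by move=> t; rewrite in_itv /= => /andP[t0 t1]; apply: db; rewrite !ltW.
- apply: continuous_in_subspaceT => t; rewrite inE /= in_itv /= => It.
  have [d1 _] := db t It.
  by apply/differentiable_continuous/derivable1_diffP.
rewrite in_itv /= => /andP[t0 t1].
exists s, t; split=> //; first by rewrite !ltW.
move: e1 e2; rewrite /a /b /second_diff !scale0r !add0r subr0.
rewrite !addrA (addrC (t *: w)) (addrC (h *: w) (s *: v)) => e1 e2.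
rewrite e2 in e1.
by rewrite expr2 mulrAC -mulrA [h * (_ * _)]mulrC -e1; ring.
Qed.

(** Schwarz's theorem: divided by h^2, the second difference tends to both mixed
    derivatives as h tends to 0. *)
Lemma derive_comm U f x v w : open U -> U x -> Ck_on 2 U f ->
  'D_v (fun y => 'D_w f y) x = 'D_w (fun y => 'D_v f y) x.
Proof.
move=> oU Ux Cf.
have near_eq v' w' (e : R) : 0 < e -> \forall h \near (0 : R)^'+,
    `|second_diff f x v' w' h / h ^+ 2 - 'D_w' (fun y => 'D_v' f y) x| < e.
  move=> e0.
  have [_ /(_ v')[_ [_ /(_ w')[_ [cDD _]]]]] := Cf.
  have /nbhs_normP[d /= d0 Pd] : \forall y \near x, U y /\
      `|'D_w' (fun y => 'D_v' f y) y - 'D_w' (fun y => 'D_v' f y) x| < e.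
    near=> y; split.
      by near: y; apply: open_nbhs_nbhs.
    by rewrite distrC; near: y; have /cvgrPdist_lt/(_ e e0) := cDD x Ux.
  (* The term 1 keeps the quotient below defined when v' and w' vanish. *)
  have N0 : 0 < `|v'| + `|w'| + 1 by rewrite ltr_wpDl // addr_ge0.
  have box h : 0 < h -> h < d / (`|v'| + `|w'| + 1) -> forall s t,
      0 <= s <= h -> 0 <= t <= h -> `|x - (s *: v' + t *: w' + x)| < d.
    move=> h0; rewrite ltr_pdivlMr // => hd s t /andP[s0 sh] /andP[t0 th].
    rewrite opprD addrCA subrr addr0 normrN.
    apply: le_lt_trans hd; apply: le_trans (ler_normD _ _) _.
    rewrite !normrZ !ger0_norm // mulrDr mulr1 mulrDr.
    by apply: ler_wpDr; [exact: ltW | rewrite lerD // ler_wpM2r].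
  near=> h.
  have h0 : 0 < h by near: h; exact: nbhs_right_gt.
  have hd : h < d / (`|v'| + `|w'| + 1).
    by near: h; apply: nbhs_right_lt; apply: divr_gt0.
  have {}box := box h h0 hd.
  have [|s [t [Is It ->]]] := @second_diff_mvt U f x v' w' h Cf h0.
    by move=> s t Is It; have [] := Pd _ (box s t Is It).
  rewrite mulrAC mulfV ?mul1r ?expf_neq0 ?gt_eqF //.
  by have [] := Pd _ (box s t Is It).
apply/eqP; rewrite -subr_eq0 -normr_le0; apply/ler_addgt0Pl => e e0.
rewrite addr0; have e20 : 0 < e / 2 by rewrite divr_gt0.
have [h [h1 h2]] := @filter_ex _ _ (at_right_proper_filter 0) _
  (filterI (near_eq v w _ e20) (near_eq w v _ e20)).
rewrite (second_diffC f x w v) in h2; move: h1 h2.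
move: ('D_w _ x) ('D_v _ x) (second_diff _ _ _ _ _ / _) => a b c h1 h2.
apply/ltW; rewrite (splitr e) (le_lt_trans _ (ltrD h1 h2)) //.
by rewrite [leRHS]addrC (distrC c b) (le_trans _ (ler_normD _ _)) // addrA subrK.
Unshelve. all: by end_near. Qed.

End CkTheory.

(** * The differential ring of smooth functions *)

Section SmoothRing.
Context {R : realType} {V : normedModType R} {U : set V}.

(** Members are total functions, arbitrary off U.  The openness of U is an argument
    because closure under products needs it, so that the ring structure can be
    found from the type smoothFun oU alone. *)
Definition smooth_pred (oU : open U) : {pred V -> R} :=
  fun f => `[< smooth_on U (f : V -> R^o) >].

Record smoothFun (oU : open U) := SmoothFun {
  smooth_val :> V -> R;
  smooth_valP : smooth_val \in smooth_pred oU }.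

Variable oU : open U.

HB.instance Definition _ := [isSub for @smooth_val oU].
HB.instance Definition _ := [Choice of smoothFun oU by <:].

Lemma mem_smooth_pred (f : V -> R^o) :
  smooth_on U f -> (f : V -> R) \in smooth_pred oU.
Proof. by move=> sf; apply/asboolP. Qed.

Definition smooth_of (f : V -> R^o) (sf : smooth_on U f) : smoothFun oU :=
  SmoothFun (mem_smooth_pred sf).

Lemma smooth_subring_closed : subring_closed (smooth_pred oU).
Proof.
split=> [|f g|f g].
- by apply/asboolP => k; apply: Ck_on_cst.
- by move=> /asboolP sf /asboolP sg; apply/asboolP => k; apply: Ck_onB.
- by move=> /asboolP sf /asboolP sg; apply/asboolP => k; apply: Ck_onM.
Qed.

HB.instance Definition _ := GRing.isSubringClosed.Build (V -> R)
  (smooth_pred oU) smooth_subring_closed.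
HB.instance Definition _ := [SubChoice_isSubComNzRing of smoothFun oU by <:].

Implicit Types f g : smoothFun oU.

Lemma smooth_on_val f : smooth_on U (f : V -> R^o).
Proof. by have /asboolP := smooth_valP f. Qed.

Lemma smoothFunP f g : (f : V -> R) =1 g -> f = g.
Proof. by move=> fg; apply/val_inj/funext. Qed.

Lemma smooth_addE f g x : (f + g) x = f x + g x. Proof. by []. Qed.
Lemma smooth_mulE f g x : (f * g) x = f x * g x. Proof. by []. Qed.
Lemma smooth_oppE f x : (- f) x = - f x. Proof. by []. Qed.
Lemma smooth_sumE I (r : seq I) (P : pred I) (f : I -> smoothFun oU) x :
  (\sum_(i <- r | P i) f i) x = \sum_(i <- r | P i) f i x.
Proof. exact: (big_morph (fun f : smoothFun oU => f x)). Qed.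

Lemma smooth_on_deriv f v :
  smooth_on U (fun x => if x \in U then 'D_v (f : V -> R^o) x else 0 : R^o).
Proof.
move=> k; have [_ /(_ v)[_]] := smooth_on_val f k.+1.
by apply: Ck_on_ext => // x Ux; rewrite mem_set.
Qed.

(** The derivative is cut off to 0 outside U: members of the ring need not be
    differentiable there, and this makes the Leibniz rule hold everywhere. *)
Definition smooth_deriv v f : smoothFun oU := smooth_of (smooth_on_deriv f v).

Lemma smooth_derivE v f x : U x -> smooth_deriv v f x = 'D_v (f : V -> R^o) x.
Proof. by move=> Ux; rewrite /= mem_set. Qed.

Lemma smooth_derivable v f x : U x -> derivable (f : V -> R^o) x v.
Proof. by move=> Ux; have [_ /(_ v)[+ _]] := smooth_on_val f 1; apply. Qed.

Lemma smooth_deriv_derivation v : derivation (smooth_deriv v).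
Proof.
split=> f g; apply: smoothFunP => x; have [Ux|nUx] := boolP (x \in U).
- have df := @smooth_derivable v f x (set_mem Ux).
  have dg := @smooth_derivable v g x (set_mem Ux).
  by rewrite smooth_addE /= Ux [LHS](deriveD df dg).
- by rewrite smooth_addE /= (negPf nUx) addr0.
- have df := @smooth_derivable v f x (set_mem Ux).
  have dg := @smooth_derivable v g x (set_mem Ux).
  by rewrite smooth_addE !smooth_mulE /= Ux [LHS](deriveM df dg) addrC mulrC.
- by rewrite smooth_addE !smooth_mulE /= (negPf nUx) mul0r mulr0 addr0.
Qed.

Lemma smooth_derivC v w f :
  smooth_deriv v (smooth_deriv w f) = smooth_deriv w (smooth_deriv v f).
Proof.
have e v' w' x : U x -> 'D_v' (smooth_deriv w' f : V -> R^o) x =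
    'D_v' (fun y => 'D_w' (f : V -> R^o) y) x.
  move=> Ux; apply: near_eq_derive; near=> y; apply: smooth_derivE; near: y.
  exact: open_nbhs_nbhs.
apply: smoothFunP => x; have [/set_mem Ux|nUx] := boolP (x \in U).
  rewrite (smooth_derivE v _ Ux) (smooth_derivE w _ Ux).
  apply: etrans (e v w x Ux) (etrans _ (esym (e w v x Ux))).
  exact: (derive_comm v w oU Ux (smooth_on_val f 2)).
by rewrite /= (negPf nUx).
Unshelve. all: by end_near. Qed.

End SmoothRing.

(** * Derivatives within an interval *)

Section TimeDerivative.
Context {R : realType}.

(** No point of a nondegenerate interval J is isolated in J, so limits within J are
    unique, also at an endpoint. *)
Lemma within_interval_proper (J : set R) (t : R) : is_interval J ->
  (exists a b, [/\ J a, J b & a < b]) -> J t -> ProperFilter (within J t^').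
Proof.
move=> iJ [a [b [Ja Jb ab]]] Jt; apply: Build_ProperFilter_ex => P.
have [u Ju ut] : exists2 u, J u & u != t.
  have [at_|] := eqVneq a t; last by exists a.
  by exists b => //; rewrite -at_ gt_eqF.
rewrite /within /= => /nbhs_normP[e /= e0 Pe].
have du : 0 < `|u - t| by rewrite normr_gt0 subr_eq0.
(* A point of J between t and u, at distance less than e from t. *)
pose r := Num.min 1 (e / (2 * `|u - t|)).
have r0 : 0 < r by rewrite lt_min ltr01 divr_gt0 // mulr_gt0.
have r1 : r <= 1 by rewrite ge_min lexx.
have re : r * `|u - t| < e.
  have : r <= e / (2 * `|u - t|) by rewrite ge_min lexx orbT.
  rewrite -(ler_pM2r du) => /le_lt_trans; apply.
  by rewrite invfM mulrA -mulrA mulVf ?gt_eqF // mulr1; lra.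
exists (t + r * (u - t)); apply: Pe.
- by rewrite /= opprD addrA subrr sub0r normrN normrM (gtr0_norm r0).
- by rewrite -subr_eq0 addrAC subrr add0r mulf_eq0 subr_eq0 negb_or (gt_eqF r0) ut.
have [tu|tu] := ltP t u; [apply: (iJ t u) | apply: (iJ u t)] => //.
all: by apply/andP; split; nra.
Qed.

Lemma has_deriv_within_unique (J : set R) f (t l l' : R) : is_interval J ->
  (exists a b, [/\ J a, J b & a < b]) -> J t ->
  has_deriv_within J f t l -> has_deriv_within J f t l' -> l = l'.
Proof.
move=> iJ nJ Jt; have PF := within_interval_proper iJ nJ Jt.
move=> h1 h2; exact: (cvg_unique _ h1 h2).
Qed.

Lemma has_deriv_within_eq (J : set R) f f' (t l : R) : J t ->
  (\forall s \near t, J s -> f s = f' s) ->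
  has_deriv_within J f' t l -> has_deriv_within J f t l.
Proof.
move=> Jt ff' h A /h hA.
have ff'' : \forall s \near t^', J s -> f s = f' s by exact: cvg_within ff'.
apply: filterS2 ff'' hA => s fs As Js; rewrite /= (nbhs_singleton ff' Jt) fs //.
exact: As.
Qed.

Lemma derivable_has_deriv_within (J : set R) (f : R -> R^o) (t : R) :
  derivable f t 1 -> has_deriv_within J f t ('D_1 f t).
Proof.
move=> df A /df [e /= e0 Ae]; exists e => //= s ts st Js.
have := Ae (s - t); rewrite /ball_ /= sub0r normrN distrC => /(_ ts).
rewrite subr_eq0 => /(_ st).
by rewrite [_%:A]mulr1 subrK mulrC.
Qed.

End TimeDerivative.
(** * Ring elements and time-dependent coordinate expressions *)

Section Realization.
Context {R : realType} {n : nat}.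
Local Notation V := (R^o * 'rV[R]_n)%type.
Context {O : set V}.
Variables (oO : open O) (J : set R).
Local Notation S := (smoothFun oO).

Definition space_deriv (i : 'I_n) : S -> S := smooth_deriv ((0, delta_mx 0 i) : V).
Definition time_deriv : S -> S := smooth_deriv ((1, 0) : V).

Lemma space_deriv_derivation i : derivation (space_deriv i).
Proof. exact: smooth_deriv_derivation. Qed.

Lemma time_deriv_derivation : derivation time_deriv.
Proof. exact: smooth_deriv_derivation. Qed.

Lemma space_derivC i j f : space_deriv i (space_deriv j f) = space_deriv j (space_deriv i f).
Proof. exact: smooth_derivC. Qed.

Lemma time_space_derivC i f : time_deriv (space_deriv i f) = space_deriv i (time_deriv f).
Proof. exact: smooth_derivC. Qed.

(** The family f is only meaningful at times in J, while F lives on an open set; f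
    and F agree where both make sense. *)
Definition realizes (f : R -> 'rV[R]_n -> R) (F : S) : Prop :=
  forall s y, J s -> O (s, y) -> f s y = F (s, y).

Lemma near_slice_space s y : O (s, y) -> \forall z \near y, O (s, z).
Proof.
move=> Osy; have : nbhs (s, y) O by apply: open_nbhs_nbhs.
by case=> -[/= A B] [nA nB] AB; apply: filterS nB => z Bz; apply: AB; split=> //=;
  exact: (nbhs_singleton nA).
Qed.

Lemma near_slice_time s y : O (s, y) -> \forall u \near s, O (u, y).
Proof.
move=> Osy; have : nbhs (s, y) O by apply: open_nbhs_nbhs.
by case=> -[/= A B] [nA nB] AB; apply: filterS nA => z Az; apply: AB; split=> //=;
  exact: (nbhs_singleton nB).
Qed.

(** A time slice of O is open, so f s and F (s, _) agree near y. *)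
Lemma realizes_pd f F i : realizes f F ->
  realizes (fun s => pd i (f s)) (space_deriv i F).
Proof.
move=> fF s y Js Osy; rewrite smooth_derivE // /pd.
have -> : 'D_(delta_mx 0 i : 'rV[R]_n) (f s : _ -> R^o) y =
    'D_(delta_mx 0 i : 'rV[R]_n) (fun z => F (s, z) : R^o) y.
  apply: near_eq_derive; apply: filterS (near_slice_space Osy) => z Osz.
  exact: fF.
have e : (fun h => h^-1 *: (((F : V -> R^o) \o shift ((s, y) : V))
      (h *: ((0, delta_mx 0 i) : V)) - F (s, y)))
  = (fun h => h^-1 *: (((fun z => F (s, z) : R^o) \o shift y)
      (h *: (delta_mx 0 i : 'rV[R]_n)) - F (s, y))).
  apply/funext => h /=; congr (_ *: (F _ - _)); congr pair; rewrite /=.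
  by rewrite scaler0 add0r.
by rewrite /derive e.
Qed.

(** The two-sided time derivative of F restricts to the derivative of f within J. *)
Lemma realizes_has_deriv f F t x : realizes f F -> J t -> O (t, x) ->
  has_deriv_within J (fun s => f s x) t (time_deriv F (t, x)).
Proof.
move=> fF Jt Otx.
apply: (has_deriv_within_eq (f' := fun s => F (s, x)) Jt).
  by apply: filterS (near_slice_time Otx) => s Osx Js; apply: fF.
have e : (fun h => h^-1 *: (((F : V -> R^o) \o shift ((t, x) : V)) (h *: ((1, 0) : V)) - F (t, x)))
  = (fun h : R => h^-1 *: (((fun s => F (s, x) : R^o) \o shift t) (h *: 1) - F (t, x))).
  apply/funext => h /=; congr (_ *: (F _ - _)); congr pair; rewrite /=.
  by rewrite scaler0 add0r.
have dF : derivable (F : V -> R^o) (t, x) (1, 0) by apply: smooth_derivable.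
rewrite smooth_derivE // /derive e; apply: derivable_has_deriv_within.
by move: dF; rewrite /derivable e.
Qed.

Lemma realizesD f f' F F' : realizes f F -> realizes f' F' ->
  realizes (fun s y => f s y + f' s y) (F + F').
Proof. by move=> fF fF' s y Js Osy; rewrite smooth_addE fF // fF'. Qed.

Lemma realizesB f f' F F' : realizes f F -> realizes f' F' ->
  realizes (fun s y => f s y - f' s y) (F - F').
Proof.
by move=> fF fF' s y Js Osy; rewrite smooth_addE smooth_oppE fF // fF'.
Qed.

Lemma realizesM f f' F F' : realizes f F -> realizes f' F' ->
  realizes (fun s y => f s y * f' s y) (F * F').
Proof. by move=> fF fF' s y Js Osy; rewrite smooth_mulE fF // fF'. Qed.

Lemma realizes_sum (f : 'I_n -> R -> 'rV[R]_n -> R) (F : 'I_n -> S) :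
  (forall i, realizes (f i) (F i)) ->
  realizes (fun s y => \sum_i f i s y) (\sum_i F i).
Proof.
by move=> fF s y Js Osy; rewrite smooth_sumE; apply: eq_bigr => i _; apply: fF.
Qed.

(** * Realization of the tensor calculus *)

Section Tensors.
Variables (gt : R -> 'rV[R]_n -> 'M[R]_n) (g gi : 'I_n -> 'I_n -> S) (half : S).
Hypothesis g_real : forall i j, realizes (fun s y => gt s y i j) (g i j).
Hypothesis gi_real : forall i j, realizes (fun s => ginv (gt s) i j) (gi i j).
Hypothesis half_real : realizes (fun _ _ => 2^-1) half.

Local Notation GammaS := (dchristoffel space_deriv half g gi).
Local Notation RupS := (driem_up space_deriv half g gi).
Local Notation RmS := (driem space_deriv half g gi).
Local Notation RcS := (dricci space_deriv half g gi).
Local Notation nabla2S := (dnabla2 space_deriv half g gi).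
Local Notation nabla3S := (dnabla3 space_deriv half g gi).
Local Notation hessS := (dhess space_deriv half g gi).

Lemma realizes_christoffel k i j :
  realizes (fun s => christoffel (gt s) k i j) (GammaS k i j).
Proof.
apply: realizesM half_real _; apply: realizes_sum => l.
apply: realizesM (gi_real k l) _.
have p a b c := realizes_pd a (g_real b c).
exact: realizesB (realizesD (p _ _ _) (p _ _ _)) (p _ _ _).
Qed.

Lemma realizes_riem_up k i j l :
  realizes (fun s => riem_up (gt s) k i j l) (RupS k i j l).
Proof.
have p a b c d := realizes_pd d (realizes_christoffel a b c).
apply: realizesD (realizesB (p _ _ _ _) (p _ _ _ _)) _.
have c := realizes_christoffel; apply: realizes_sum => q.
exact: realizesB (realizesM (c _ _ _) (c _ _ _)) (realizesM (c _ _ _) (c _ _ _)).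
Qed.

Lemma realizes_riem i j k l : realizes (fun s => riem (gt s) i j k l) (RmS i j k l).
Proof.
apply: realizes_sum => p; exact: realizesM (g_real k p) (realizes_riem_up p i j l).
Qed.

Lemma realizes_gtrace t T : (forall i j, realizes (t i j) (T i j)) ->
  realizes (fun s y => \sum_j \sum_l ginv (gt s) j l y * t j l s y) (gtrace gi T).
Proof.
move=> tT; apply: realizes_sum => j; apply: realizes_sum => l.
exact: realizesM (gi_real j l) (tT j l).
Qed.

Lemma realizes_ricci i k : realizes (fun s => ricci (gt s) i k) (RcS i k).
Proof. exact: realizes_gtrace (fun j l => realizes_riem i j k l). Qed.

Lemma realizes_nabla2 t T : (forall i j, realizes (fun s => t s i j) (T i j)) ->
  forall a i j, realizes (fun s => nabla2 (gt s) (t s) a i j) (nabla2S T a i j).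
Proof.
move=> tT a i j; apply: realizesB (realizes_pd a (tT i j)) _.
apply: realizes_sum => p; have c := realizes_christoffel p a.
exact: realizesD (realizesM (c _) (tT _ _)) (realizesM (c _) (tT _ _)).
Qed.

Lemma realizes_nabla3 t T : (forall i j k, realizes (fun s => t s i j k) (T i j k)) ->
  forall a i j k, realizes (fun s => nabla3 (gt s) (t s) a i j k) (nabla3S T a i j k).
Proof.
move=> tT a i j k; apply: realizesB (realizes_pd a (tT i j k)) _.
apply: realizes_sum => p; have c := realizes_christoffel p a.
exact: realizesD (realizesD (realizesM (c _) (tT _ _ _)) (realizesM (c _) (tT _ _ _)))
  (realizesM (c _) (tT _ _ _)).
Qed.

Lemma realizes_hess t T : (forall i j, realizes (fun s => t s i j) (T i j)) ->
  forall a b i j, realizes (fun s => hess (gt s) (t s) a b i j) (hessS T a b i j).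
Proof. by move=> tT; apply: realizes_nabla3 (realizes_nabla2 tT). Qed.

(** The coordinate counterpart of dlin_ricci. *)
Definition lin_ricci (G : 'rV[R]_n -> 'M[R]_n) (h : 'I_n -> 'I_n -> 'rV[R]_n -> R)
    (i k : 'I_n) (x : 'rV[R]_n) : R :=
  \sum_j \sum_l ginv G j l x *
    (hess G h i l k j x - hess G h i k j l x - hess G h j l k i x + hess G h j k i l x)
  + \sum_m \sum_q ginv G m q x *
    (h k m x * ricci G i q x
     - \sum_j \sum_l ginv G j l x * (h m l x * riem G i j k q x)).

Lemma realizes_lin_ricci t T : (forall i j, realizes (fun s => t s i j) (T i j)) ->
  forall i k, realizes (fun s => lin_ricci (gt s) (t s) i k)
    (dlin_ricci space_deriv half g gi T i k).
Proof.
move=> tT i k; have hT := realizes_hess tT.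
apply: realizesD.
  apply: realizes_gtrace => j l.
  exact: realizesD (realizesB (realizesB (hT _ _ _ _) (hT _ _ _ _)) (hT _ _ _ _))
    (hT _ _ _ _).
apply: realizes_gtrace => m q; apply: realizesB (realizesM (tT _ _) (realizes_ricci _ _)) _.
apply: realizes_gtrace => j l; exact: realizesM (tT _ _) (realizes_riem _ _ _ _).
Qed.

Definition dsq2 (F : 'I_n -> 'I_n -> S) (i j : 'I_n) : S :=
  \sum_k \sum_l gi k l * F i l * F j k.

Definition dsq3 (H : 'I_n -> 'I_n -> 'I_n -> S) (i j : 'I_n) : S :=
  \sum_k \sum_l \sum_p \sum_q gi k p * gi l q * H i k l * H j p q.

Lemma realizes_sq2 t T : (forall i j, realizes (fun s => t s i j) (T i j)) ->
  forall i j, realizes (fun s => sq2 (gt s) (t s) i j) (dsq2 T i j).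
Proof.
move=> tT i j; apply: realizes_sum => k; apply: realizes_sum => l.
exact: realizesM (realizesM (gi_real _ _) (tT _ _)) (tT _ _).
Qed.

Lemma realizes_sq3 t T : (forall i j k, realizes (fun s => t s i j k) (T i j k)) ->
  forall i j, realizes (fun s => sq3 (gt s) (t s) i j) (dsq3 T i j).
Proof.
move=> tT i j; apply: realizes_sum => k; apply: realizes_sum => l.
apply: realizes_sum => p; apply: realizes_sum => q.
exact: realizesM (realizesM (realizesM (gi_real _ _) (gi_real _ _)) (tT _ _ _)) (tT _ _ _).
Qed.

End Tensors.

End Realization.

(** * Smooth extensions and inversion of the metric *)

Section Localisation.
Context {R : realType} {V : normedModType R}.

Lemma smooth_within_fin (I : finType) (D : set V) (f : I -> V -> R^o) p :
  D p -> (forall i, smooth_within D (f i)) ->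
  exists (O : set V) (F : I -> V -> R^o), [/\ open O, O p,
    forall i, smooth_on O (F i) & forall i q, O q -> D q -> f i q = F i q].
Proof.
move=> Dp sf; have /choice[OF OFP] i := sf i p Dp.
have /choice[F FP] := OFP.
exists [set q | forall i, OF i q], F; split.
- rewrite openE => q Oq; apply: filter_forall => i.
  by apply: open_nbhs_nbhs; split=> //; have [] := FP i.
- by move=> i; have [] := FP i.
- move=> i k; have [_ _ sF _] := FP i; apply: Ck_on_sub (sF k) => q; exact.
- by move=> i q Oq Dq; have [_ _ _ ->] := FP i.
Qed.

Variables (U : set V) (oU : open U).

(** Evaluation as a ring morphism, to commute it with determinants. *)
Definition smooth_eval (x : V) (f : smoothFun oU) : R := f x.

HB.instance Definition _ x := GRing.isZmodMorphism.Build _ _ (smooth_eval x)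
  (fun f g => erefl).
HB.instance Definition _ x := GRing.isMonoidMorphism.Build _ _ (smooth_eval x)
  (conj erefl (fun f g => erefl)).

Lemma smooth_det_val n (A : 'M[smoothFun oU]_n) x :
  (\det A) x = \det (\matrix_(i, j) (A i j : V -> R) x).
Proof.
rewrite -[LHS]/(smooth_eval x (\det A)) -det_map_mx; congr (\det _).
by apply/matrixP => i j; rewrite !mxE.
Qed.

Lemma smooth_unit (f : smoothFun oU) : (forall x, f x != 0) ->
  exists f', f * f' = 1.
Proof.
move=> f0; have sV : smooth_on U (fun x => (f x)^-1 : R^o).
  by move=> k; apply: Ck_onV => //; apply: smooth_on_val.
by exists (smooth_of oU sV); apply: smoothFunP => x; rewrite smooth_mulE /= mulfV.
Qed.

Lemma smooth_extend (f : V -> R^o) (c : R) : smooth_on U f ->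
  exists F : smoothFun oU, (forall x, U x -> F x = f x) /\ (forall x, ~ U x -> F x = c).
Proof.
move=> sf; have sF : smooth_on U (fun x => if x \in U then f x else c).
  by move=> k; apply: Ck_on_ext (sf k) => // x Ux; rewrite mem_set.
exists (smooth_of oU sF); split=> x Ux /=; first by rewrite mem_set.
by rewrite memNset.
Qed.

(** Off U the entries are replaced by those of the identity matrix, so that the
    determinant vanishes nowhere and is a unit of the ring; the inverse matrix is
    then given by the adjugate. *)
Lemma smooth_metric n (f : 'I_n -> 'I_n -> V -> R^o) :
  (forall i j, smooth_on U (f i j)) ->
  (forall i j x, f i j x = f j i x) ->
  (forall x, U x -> \det (\matrix_(i, j) f i j x) != 0) ->
  exists g gi : 'I_n -> 'I_n -> smoothFun oU,
    [/\ forall i j x, U x -> g i j x = f i j x, forall i j, g i j = g j i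
      & forall i j, \sum_k g i k * gi k j = (i == j)%:R].
Proof.
move=> sf fC f0.
have /choice[g2 gP] (ij : 'I_n * 'I_n) :=
  smooth_extend (ij.1 == ij.2)%:R (sf ij.1 ij.2).
pose g i j := g2 (i, j); pose G : 'M[smoothFun oU]_n := \matrix_(i, j) g i j.
have [d dP] : exists d, \det G * d = 1.
  apply: smooth_unit => x; rewrite smooth_det_val.
  have [Ux|nUx] := pselect (U x).
    rewrite (_ : \matrix_(i, j) _ = \matrix_(i, j) f i j x) ?f0 //.
    by apply/matrixP => i j; rewrite !mxE; apply: (gP (i, j)).1.
  rewrite (_ : \matrix_(i, j) _ = 1%:M) ?det1 ?oner_eq0 //.
  by apply/matrixP => i j; rewrite !mxE; apply: (gP (i, j)).2.
exists g, (fun i j => d * (\adj G) i j); split.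
- by move=> i j x Ux; apply: (gP (i, j)).1.
- move=> i j; apply: smoothFunP => x; have [Ux|nUx] := pselect (U x).
    by rewrite (gP (i, j)).1 // (gP (j, i)).1.
  by rewrite (gP (i, j)).2 // (gP (j, i)).2 //= eq_sym.
- move=> i j; have /matrixP/(_ i j) := mul_mx_adj G.
  rewrite !mxE => e; transitivity (d * \sum_k G i k * (\adj G) k j).
    by rewrite mulr_sumr; apply: eq_bigr => k _; rewrite [G i k]mxE; ring.
  by rewrite e mulrnAr mulrC dP.
Qed.

End Localisation.

(** * The Ricci tensor along the flow *)

Definition flow_velocity {R : realType} {n : nat} (G : 'rV[R]_n -> 'M[R]_n)
    (F : 'I_n -> 'I_n -> 'rV[R]_n -> R) (H : 'I_n -> 'I_n -> 'I_n -> 'rV[R]_n -> R)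
    (i j : 'I_n) (x : 'rV[R]_n) : R :=
  - 2 * (ricci G i j x - 4^-1 * sq3 G H i j x - sq2 G F i j x).

Section Evolution.
Context {R : realType} {n : nat}.
Local Notation V := (R^o * 'rV[R]_n)%type.
Context {O : set V}.
Variables (oO : open O) (J : set R).
Local Notation S := (smoothFun oO).
Hypothesis J_interval : is_interval J.
Hypothesis J_nontrivial : exists a b : R, [/\ J a, J b & a < b].
Variables (gt : R -> 'rV[R]_n -> 'M[R]_n) (g gi : 'I_n -> 'I_n -> S).
Hypothesis g_sym : forall i j, g i j = g j i.
Hypothesis g_gi : forall i j, \sum_k g i k * gi k j = (i == j)%:R.
Hypothesis g_real : forall i j, realizes J (fun s y => gt s y i j) (g i j).

Lemma realizes_ginv i j : realizes J (fun s => ginv (gt s) i j) (gi i j).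
Proof.
move=> s y Js Osy; pose Gi : 'M[R]_n := \matrix_(i, j) gi i j (s, y).
have gGi : gt s y *m Gi = 1%:M.
  apply/matrixP => a b; rewrite !mxE.
  have -> : (a == b)%:R = ((a == b)%:R : S) (s, y) by case: (a == b).
  rewrite -g_gi smooth_sumE; apply: eq_bigr => k _.
  by rewrite smooth_mulE mxE (g_real a k Js Osy).
have [u _] := mulmx1_unit gGi.
rewrite /ginv -[invmx _]mulmx1 -gGi mulKmx //; exact: mxE.
Qed.

Definition smooth_half : S :=
  smooth_of oO (fun k => Ck_on_cst k O (2^-1 : R)).

Lemma smooth_half2 : smooth_half + smooth_half = 1.
Proof. by apply: smoothFunP => x; rewrite smooth_addE [RHS]splitr mul1r. Qed.

Variables (Ft : R -> 'I_n -> 'I_n -> 'rV[R]_n -> R)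
  (Ht : R -> 'I_n -> 'I_n -> 'I_n -> 'rV[R]_n -> R)
  (F : 'I_n -> 'I_n -> S) (H : 'I_n -> 'I_n -> 'I_n -> S).
Hypothesis F_real : forall i j, realizes J (fun s => Ft s i j) (F i j).
Hypothesis H_real : forall i j k, realizes J (fun s => Ht s i j k) (H i j k).

Local Notation velocity := (fun s => flow_velocity (gt s) (Ft s) (Ht s)).

Hypothesis flow : forall s y i j, J s -> O (s, y) ->
  has_deriv_within J (fun u => gt u y i j) s (velocity s i j y).

Let gi_real := realizes_ginv.
Let half_real : realizes J (fun _ _ => 2^-1) smooth_half.
Proof. by []. Qed.
Local Notation RcS := (dricci (@space_deriv R n O oO) smooth_half g gi).
Local Notation hessS := (dhess (@space_deriv R n O oO) smooth_half g gi).
Local Notation LS := (dlin_ricci (@space_deriv R n O oO) smooth_half g gi).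
Local Notation two := (1 + 1 : S).

(* The time derivative of g i j may differ from the velocity off J, but both are
   derivatives within J at the times of J. *)
Let dt_g i j : realizes J (fun s => velocity s i j) (time_deriv (g i j)).
Proof.
move=> s y Js Osy; apply: (has_deriv_within_unique J_interval J_nontrivial Js).
  exact: flow.
exact: realizes_has_deriv (g_real i j) Js Osy.
Qed.

(* The velocity as an element of the ring, in the form to which linearity of
   dlin_ricci applies. *)
Let velocityS i j : S :=
  - two * RcS i j + (smooth_half * dsq3 gi H i j + two * dsq2 gi F i j).

Let velocityS_real i j : realizes J (fun s => velocity s i j) (velocityS i j).
Proof.
move=> s y Js Osy; rewrite /velocityS /flow_velocity.
rewrite (realizes_ricci g_real gi_real half_real i j Js Osy).
rewrite (realizes_sq2 gi_real F_real i j Js Osy).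
rewrite (realizes_sq3 gi_real H_real i j Js Osy).
set a := RcS i j; set b := dsq3 _ _ _ _; set c := dsq2 _ _ _ _.
rewrite -[RHS]/(- (1 + 1) * a (s, y) + (2^-1 * b (s, y) + (1 + 1) * c (s, y))).
by lra.
Qed.

Let sd_der i : derivation (@space_deriv R n O oO i) := space_deriv_derivation oO i.
Let sd_comm i j (f : S) := space_derivC i j f.
Let td_der := @time_deriv_derivation R n O oO.
Let td_comm i (f : S) := time_space_derivC i f.

(** The ring identity dricci_var, evaluated at (t, x).  There the ring element
    dlin_ricci of the time derivative of g may be computed from the velocity, as
    dlin_ricci only takes spatial derivatives. *)
Lemma ricci_deriv_flow t x i k : J t -> O (t, x) ->
  has_deriv_within J (fun s => ricci (gt s) i k x) t
    (2^-1 * lin_ricci (gt t) (velocity t) i k x).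
Proof.
move=> Jt Otx.
have ric_real := realizes_ricci g_real gi_real half_real i k.
have := realizes_has_deriv ric_real Jt Otx.
rewrite (dricci_var sd_der sd_comm smooth_half2 g_sym g_gi td_der td_comm).
by rewrite smooth_mulE -(realizes_lin_ricci g_real gi_real half_real dt_g i k Jt Otx).
Qed.

(** The velocity is a combination of Rc, HH and FF with constant coefficients; the
    ring element velocityS, which realizes it as well, is decomposed linearly. *)
Lemma lin_ricci_velocity t x i k : J t -> O (t, x) ->
  2^-1 * lin_ricci (gt t) (velocity t) i k x =
  laplacian (gt t) (ricci (gt t)) i k x
  + 2 * (\sum_p \sum_r ginv (gt t) p r x * \sum_q \sum_s ginv (gt t) q s x *
          (riem (gt t) p i q k x * ricci (gt t) r s x))
  - 2 * (\sum_p \sum_q ginv (gt t) p q x * (ricci (gt t) p i x * ricci (gt t) q k x))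
  + 4^-1 * lin_ricci (gt t) (sq3 (gt t) (Ht t)) i k x
  + lin_ricci (gt t) (sq2 (gt t) (Ft t)) i k x.
Proof.
move=> Jt Otx.
have ric_real := realizes_ricci g_real gi_real half_real.
have rm_real := realizes_riem g_real gi_real half_real.
have sq2_real := realizes_sq2 gi_real F_real.
have sq3_real := realizes_sq3 gi_real H_real.
have var_real := realizes_lin_ricci g_real gi_real half_real.
rewrite (var_real _ _ velocityS_real i k _ _ Jt Otx).
rewrite (var_real _ _ sq2_real i k _ _ Jt Otx) (var_real _ _ sq3_real i k _ _ Jt Otx).
have lap_real : realizes J (fun s => laplacian (gt s) (ricci (gt s)) i k)
    (gtrace gi (fun a b => hessS RcS a b i k)).
  apply: (realizes_gtrace gi_real) => a b.
  exact: (realizes_hess g_real gi_real half_real ric_real).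
have rmric_real := realizes_gtrace gi_real (fun p r => realizes_gtrace gi_real (fun q s =>
  realizesM (rm_real p i q k) (ric_real r s))).
have ricric_real := realizes_gtrace gi_real (fun p q =>
  realizesM (ric_real p i) (ric_real q k)).
rewrite (lap_real _ _ Jt Otx) (rmric_real _ _ Jt Otx) (ricric_real _ _ Jt Otx).
have d2 a : space_deriv a two = 0.
  by rewrite (sd_der a).1 (der1 (sd_der a)) addr0.
have dN2 a : space_deriv a (- two) = 0.
  by rewrite (derN (sd_der a)) d2 oppr0.
have dh a : space_deriv a smooth_half = 0.
  by apply: (der_half (sd_der a)); exact: smooth_half2.
rewrite /velocityS 2!(dlin_ricciD smooth_half g gi sd_der).
rewrite !(dlin_ricciZ smooth_half g gi) //.
rewrite (dlin_ricci_dricci sd_der sd_comm smooth_half2 g_sym g_gi).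
set L := gtrace gi _; set A := gtrace gi _; set B := gtrace gi _.
set E3 := LS _ _ _; set E2 := LS _ _ _.
move: L A B E3 E2 => L A B E3 E2; pose q : V := (t, x).
rewrite -[X in 2^-1 * X]/(- (1 + 1) * (- L q - (1 + 1) * A q + (1 + 1) * B q)
  + (2^-1 * E3 q + (1 + 1) * E2 q)) -/q.
by field.
Qed.

End Evolution.

(** * The evolution equation in a chart *)

Lemma posdef_det_neq0 (R : realType) (n : nat) (A : 'M[R]_n) :
  (forall v : 'rV[R]_n, v != 0 -> 0 < (v *m A *m v^T) 0 0) -> \det A != 0.
Proof.
move=> posA; apply/det0P => -[v v0 vA].
by have := posA v v0; rewrite vA mul0mx mxE ltxx.
Qed.

Lemma open_smooth_neq0 (R : realType) (V : normedModType R) (U : set V) (oU : open U)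
  (f : smoothFun oU) : open (U `&` [set q | f q != 0]).
Proof.
rewrite openE => q [Uq fq0]; apply: filterI; first exact: open_nbhs_nbhs.
have [cf _] := smooth_on_val f 0; have fq := cf q Uq.
have n0 : nbhs (f q : R^o) [set r : R^o | r != 0].
  by apply: open_nbhs_nbhs; split=> //; exact: open_neq.
exact: (fq _ n0).
Qed.

(** All components extend to one open set, which is then shrunk to the points over
    the chart at which the determinant of g is nonzero; positivity of g keeps
    (t, x) in it.  The extension of g is symmetrised, since extensions of g_ij and
    g_ji need not agree off J. *)
Lemma local_smooth_extension (R : realType) (n : nat) (M : smooth_manifold R n) (J : set R)
    (gt : cov2_family M) (At : cov1_family M) (Bt : cov2_family M) c t x :
  metric_family J gt -> smooth_cov1 J At -> smooth_cov2 J Bt ->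
  atlas c -> J t -> cimg c x ->
  exists (O : set (R^o * 'rV[R]_n)) (oO : open O)
    (g gi b : 'I_n -> 'I_n -> smoothFun oO) (a : 'I_n -> smoothFun oO),
  [/\ O (t, x), forall s y, O (s, y) -> cimg c y,
      (forall i j, g i j = g j i) /\
      (forall i j, \sum_k g i k * gi k j = (i == j)%:R),
      forall i j, realizes J (fun s y => gt c s y i j) (g i j)
    & (forall i, realizes J (fun s y => At c s y 0 i) (a i)) /\
      (forall i j, realizes J (fun s y => Bt c s y i j) (b i j))].
Proof.
move=> [[_ sg] pg] [_ sA] [_ sB] ac Jt cx.
(* One index type for the components of g, A and B. *)
pose I : finType := (('I_n * 'I_n) + 'I_n + ('I_n * 'I_n))%type.
pose f (u : I) (q : R^o * 'rV[R]_n) : R^o := match u with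
  | inl (inl ij) => gt c q.1 q.2 ij.1 ij.2
  | inl (inr i) => At c q.1 q.2 0 i
  | inr ij => Bt c q.1 q.2 ij.1 ij.2 end.
have sfu (u : I) : smooth_within (J `*` cimg c) (f u).
  by case: u => [[[i j]|i]|[i j]]; [apply: sg | apply: sA | apply: sB].
have [D1 [F1 [oO1 O1p sF1 fF1]]] :=
  smooth_within_fin (conj Jt cx : (J `*` cimg c) (t, x)) sfu.
pose O2 := D1 `&` [set q | cimg c q.2].
have oO2 : open O2.
  apply: openI => //; apply: (@open_comp _ _ snd); last exact: cimg_open.
  by move=> q _; exact: cvg_snd.
have sF2 u : smooth_on O2 (F1 u).
  by move=> k; apply: Ck_on_sub (sF1 u k) => q [].
pose sm u : smoothFun oO2 := smooth_of oO2 (sF2 u).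
pose h : smoothFun oO2 := smooth_half oO2.
pose G i j := h * (sm (inl (inl (i, j))) + sm (inl (inl (j, i)))).
have GC i j q : G i j q = G j i q by rewrite /G addrC.
have Gg i j s y : J s -> O2 (s, y) -> gt c s y i j = G i j (s, y).
  move=> Js [Os /= cy]; have [gT _] := pg c s y ac Js cy.
  have e i' j' : F1 (inl (inl (i', j'))) (s, y) = gt c s y i' j'.
    by rewrite -(fF1 (inl (inl (i', j')))).
  rewrite -[RHS]/(2^-1 * (F1 (inl (inl (i, j))) (s, y) + F1 (inl (inl (j, i))) (s, y))).
  by rewrite !e -[in gt c s y j i]gT mxE; field.
pose O := O2 `&` [set q | (\det (\matrix_(i, j) G i j)) q != 0].
have oO : open O by apply: open_smooth_neq0.
have sG i j : smooth_on O (G i j : _ -> R^o).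
  by move=> k; apply: Ck_on_sub (smooth_on_val (G i j) k) => q [].
have [|q [_ /=]|g [gi [gG gC ggi]]] := smooth_metric oO sG; first exact: GC.
  by rewrite smooth_det_val; under eq_mx do rewrite mxE.
have sFO u : smooth_on O (F1 u).
  by move=> k; apply: Ck_on_sub (sF2 u k) => q [].
pose sn u : smoothFun oO := smooth_of oO (sFO u).
exists O, oO, g, gi, (fun i j => sn (inr (i, j))), (fun i => sn (inl (inr i))).
split.
- split; first by split.
  rewrite /= smooth_det_val.
  have -> : \matrix_(i, j) (\matrix_(i, j) G i j) i j (t, x) = gt c t x.
    by apply/matrixP => i j; rewrite !mxE -Gg.
  by apply: posdef_det_neq0; exact: (pg c t x ac Jt cx).2.
- by move=> s y [[_ cy] _].
- by split.
- by move=> i j s y Js Osy; rewrite gG // -Gg //; case: Osy.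
split=> [i|i j] s y Js [[D1s cy] _].
- by rewrite -[RHS](fF1 (inl (inr i)) (s, y) D1s).
- by rewrite -[RHS](fF1 (inr (i, j)) (s, y) D1s).
Qed.

Theorem theorem5p2 (R : realType) (n : nat) (M : smooth_manifold R n)
  (compact_M : compact [set: M])
  (J : set R) (J_interval : is_interval J)
  (J_nontrivial : exists a b : R, [/\ J a, J b & a < b])
  (gt : cov2_family M) (At : cov1_family M) (Bt : cov2_family M)
  (sol : flow_solution J gt At Bt) :
  forall (c : chart R n M) (t : R) (x : 'rV[R]_n) (i k : 'I_n),
  atlas c -> J t -> cimg c x ->
  let g := gt c t in
  let F := d_one (At c t) in
  let H := d_two (Bt c t) in
  let gi := fun a b => ginv g a b x in
  let Rm := fun a b c d => riem g a b c d x in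
  let Rc := fun a b => ricci g a b x in
  let HH := fun a b => sq3 g H a b x in
  let FF := fun a b => sq2 g F a b x in
  let DDHH := fun a b c d => hess g (sq3 g H) a b c d x in
  let DDFF := fun a b c d => hess g (sq2 g F) a b c d x in
  has_deriv_within J (fun s => ricci (gt c s) i k x) t
    (laplacian g (ricci g) i k x
     + 2 * (\sum_p \sum_q \sum_r \sum_s
              gi p r * gi q s * Rm p i q k * Rc r s)
     - 2 * (\sum_p \sum_q gi p q * Rc p i * Rc q k)
     + 4^-1 * (\sum_j \sum_l gi j l *
         (DDHH i l k j - DDHH i k j l - DDHH j l k i + DDHH j k i l))
     + 4^-1 * (\sum_m \sum_n gi m n *
         (HH k m * Rc i n
          - \sum_j \sum_l gi j l * HH m l * Rm i j k n))
     + (\sum_j \sum_l gi j l *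
         (DDFF i l k j - DDFF i k j l - DDFF j l k i + DDFF j k i l))
     + (\sum_m \sum_n gi m n *
         (FF k m * Rc i n
          - \sum_j \sum_l gi j l * FF m l * Rm i j k n))).
Proof.
move=> c t x i k ac Jt cx g F H gi Rm Rc HH FF DDHH DDFF.
have [metric oneform [twoform _] flow _ _] := sol.
have [U [oU [sg [sgi [b [a [Utx Uc [gC ggi] g_real [a_real b_real]]]]]]]] :=
  local_smooth_extension metric oneform twoform ac Jt cx.
have F_real i' j' : realizes J (fun s => d_one (At c s) i' j')
    (space_deriv i' (a j') - space_deriv j' (a i')).
  exact: realizesB (realizes_pd _ (a_real _)) (realizes_pd _ (a_real _)).
have H_real i' j' k' : realizes J (fun s => d_two (Bt c s) i' j' k')
    (space_deriv i' (b j' k') + space_deriv j' (b k' i') + space_deriv k' (b i' j')).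
  exact: realizesD (realizesD (realizes_pd _ (b_real _ _)) (realizes_pd _ (b_real _ _)))
    (realizes_pd _ (b_real _ _)).
have flowU s y i' j' : J s -> U (s, y) -> has_deriv_within J
    (fun u => gt c u y i' j') s
    (flow_velocity (gt c s) (d_one (At c s)) (d_two (Bt c s)) i' j' y).
  by move=> Js Usy; apply: flow => //; apply: Uc Usy.
have := ricci_deriv_flow J_interval J_nontrivial gC ggi g_real flowU
  (i := i) (k := k) Jt Utx.
rewrite (lin_ricci_velocity gC ggi g_real F_real H_real i k Jt Utx) => D.
apply: (eq_ind _ (has_deriv_within J _ t) D).
have sumA (w u v : 'I_n -> 'I_n -> R) :
    \sum_j \sum_l w j l * (u j l * v j l) = \sum_j \sum_l w j l * u j l * v j l.
  by apply: eq_bigr => j _; apply: eq_bigr => l _; rewrite mulrA.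
rewrite /lin_ricci mulrDr !addrA.
congr (_ + 2 * _ - 2 * _ + 4^-1 * _ + 4^-1 * _ + _ + _).
(* What remains are the different groupings of the contractions. *)
- apply: eq_bigr => p _; rewrite [RHS]exchange_big; apply: eq_bigr => r _.
  rewrite mulr_sumr; apply: eq_bigr => q _; rewrite mulr_sumr.
  by apply: eq_bigr => s _; rewrite !mulrA.
- exact: sumA.
- apply: eq_bigr => m _; apply: eq_bigr => q _; congr (_ * (_ - _)); exact: sumA.
- apply: eq_bigr => m _; apply: eq_bigr => q _; congr (_ * (_ - _)); exact: sumA.
Qed.
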